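(* Let $X$ be a compact hyperbolic surface. Then for all closed geodesics $\alpha,\beta$ on $X$, $$i(\alpha,\beta)\le \frac{4}{\mathrm{sys}(X)^2}\,\ell_X(\alpha)\,\ell_X(\beta).$$
   Context: $\ell_X(\gamma)$ is the length of a closed geodesic $\gamma$ on $X$, and $\mathrm{sys}(X)$ is the minimum of $\ell_X(\gamma)$ over all closed geodesics $\gamma$ on $X$. $i(\alpha,\beta)$ is the geometric intersection number: the minimal number of transversal intersection points, counted with multiplicity, between a representative of the homotopy class $[\alpha]$ and a representative of $[\beta]$. *)

(* Defs.v *)
From HB Require Import structures.
From mathcomp Require Import all_boot all_order all_algebra generic_quotient.
From mathcomp Require Import all_classical all_reals all_analysis.
Import Order.TTheory GRing.Theory Num.Theory numFieldNormedType.Exports.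

Set Implicit Arguments.
Unset Strict Implicit.
Unset Printing Implicit Defensive.

Local Open Scope classical_set_scope.
Local Open Scope ring_scope.
Local Open Scope quotient_scope.

Section HyperbolicPlane.
Variable R : realType.

Definition upper_half_plane : set (R * R) := [set z | 0 < z.2].

(* Coerced to a type, this set carries the subspace topology of R * R. *)
Definition hplane : Type := upper_half_plane.

HB.instance Definition _ := Topological.on hplane.

Definition arcosh (c : R) : R := ln (c + Num.sqrt (c ^+ 2 - 1)).

(* Distance of the metric (dx^2 + dy^2) / y^2, of curvature -1. *)
Definition hdist (z w : hplane) : R :=
  let p := set_val z in let q := set_val w in
  arcosh (1 + ((p.1 - q.1) ^+ 2 + (p.2 - q.2) ^+ 2) / (2 * p.2 * q.2)).

Definition hisometry (g : hplane -> hplane) : Prop :=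
  forall z w, hdist (g z) (g w) = hdist z w.

End HyperbolicPlane.

(* A complete connected hyperbolic surface without boundary is a quotient of
   the hyperbolic plane by a group of isometries that acts freely and properly
   discontinuously. Orientation-reversing isometries are allowed, so the
   surface may be non-orientable. *)
Record hyperbolic_surface (R : realType) := HyperbolicSurface {
  deck : set (hplane R -> hplane R);
  deck_isometry : forall g, deck g -> hisometry g;
  deck_id : deck id;
  deck_comp : forall g h, deck g -> deck h -> deck (g \o h);
  deck_inv : forall g, deck g -> exists2 h, deck h & cancel g h /\ cancel h g;
  deck_free : forall g z, deck g -> g z = z -> g = id;
  deck_properly_discontinuous : forall K : set (hplane R), compact K ->
    finite_set [set g | deck g /\ (g @` K) `&` K !=set0]
}.

Section Surface.
Variables (R : realType) (X : hyperbolic_surface R).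

Definition same_orbit (z w : hplane R) : bool :=
  `[< exists2 g, deck X g & g z = w >].

Lemma same_orbit_refl : reflexive same_orbit.
Proof. by move=> z; apply/asboolP; exists id => //; exact: deck_id. Qed.

Lemma same_orbit_sym : symmetric same_orbit.
Proof.
suff imp z w : same_orbit z w -> same_orbit w z.
  by move=> z w; apply/idP/idP; exact: imp.
move=> /asboolP[g /deck_inv[h Xh [gK _]] <-]; apply/asboolP.
by exists h => //; exact: gK.
Qed.

Lemma same_orbit_trans : transitive same_orbit.
Proof.
move=> w z v /asboolP[g Xg <-] /asboolP[h Xh <-]; apply/asboolP.
by exists (h \o g) => //; exact: deck_comp.
Qed.

Canonical same_orbit_equiv :=
  EquivRel same_orbit same_orbit_refl same_orbit_sym same_orbit_trans.

Definition points : Type := quotient_topology {eq_quot same_orbit_equiv}.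

HB.instance Definition _ := Topological.on points.

Definition surface_proj (z : hplane R) : points :=
  \pi_{eq_quot same_orbit_equiv} z.

(* Unit-speed parametrisation, hence the length of the closed curve is its
   period. The period need not be minimal, so multiple coverings of a closed
   geodesic are allowed. *)
Record closed_geodesic := ClosedGeodesic {
  geodesic_map : R -> points;
  geodesic_length : R;
  geodesic_length_gt0 : 0 < geodesic_length;
  geodesic_periodic : forall t,
    geodesic_map (t + geodesic_length) = geodesic_map t;
  geodesic_local : forall t, exists e : R, exists c : R -> hplane R,
    [/\ 0 < e,
        {in `]t - e, t + e[, forall s, geodesic_map s = surface_proj (c s)} &
        {in `]t - e, t + e[ &, forall s s', hdist (c s) (c s') = `|s - s'|}]
}.

Definition systole : R := inf (range geodesic_length).

(* Loops are 1-periodic maps, i.e. maps on the circle R / Z. *)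
Definition is_loop (a : R -> points) : Prop :=
  continuous a /\ forall t, a (t + 1) = a t.

Definition geodesic_loop (g : closed_geodesic) (t : R) : points :=
  geodesic_map g (geodesic_length g * t).

Definition freely_homotopic (a b : R -> points) : Prop :=
  exists F : R * R -> points,
  [/\ {within `[0, 1] `*` [set: R], continuous F},
      forall s, s \in `[0, 1] -> forall t, F (s, t + 1) = F (s, t),
      forall t, F (0, t) = a t &
      forall t, F (1, t) = b t].

(* Transversality of a at time s and b at time t, read in the half-plane chart:
   the velocities of local lifts through a common point are linearly
   independent. *)
Definition transversal_at (a b : R -> points) (s t : R) : Prop :=
  exists la lb : R -> hplane R,
  [/\ \forall x \near s, surface_proj (la x) = a x,
      \forall x \near t, surface_proj (lb x) = b x,
      la s = lb t &
      exists u v : R * R,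
      [/\ is_derive s 1 (fun x => (set_val (la x)).1) u.1,
          is_derive s 1 (fun x => (set_val (la x)).2) u.2,
          is_derive t 1 (fun x => (set_val (lb x)).1) v.1,
          is_derive t 1 (fun x => (set_val (lb x)).2) v.2 &
          u.1 * v.2 - u.2 * v.1 != 0]].

Definition transversal_loops (a b : R -> points) : Prop :=
  forall s t, a s = b t -> transversal_at a b s t.

(* Counting pairs of parameters, rather than points of the surface, gives each
   intersection point its multiplicity. *)
Definition intersections (a b : R -> points) : set (R * R) :=
  [set p | [/\ p.1 \in `[0, 1[, p.2 \in `[0, 1[ & a p.1 = b p.2]].

(* The infimum ranges over {0, 1, ..., +oo}, so it is a minimum; it would be +oo
   if there were no transversal representatives with finitely many
   intersections. *)
Definition intersection_number (a b : closed_geodesic) : \bar R :=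
  ereal_inf [set n | exists a' b' : R -> points,
    [/\ is_loop a' /\ freely_homotopic (geodesic_loop a) a',
        is_loop b' /\ freely_homotopic (geodesic_loop b) b',
        transversal_loops a' b' &
        n = counting (intersections a' b')]].

End Surface.

(* Main.v *)
(* Lift the two closed geodesics to lines A and B of the hyperbolic plane, with
   periods a and b, and let L be half the systole. Every nontrivial deck
   transformation displaces every point by at least 2 L: a displacement of minimal
   size is realised along the axis of a closed geodesic.

   If a lift of A meets a lift of B at parameters (s, t) and again at (s', t') with
   |s - s'| < L and |t - t'| < L, then some deck transformation moves a point by less
   than 2 L, so both crossings are on the same pair of lifts, and two distinct lines
   meet at most once. Hence transversal crossings are L-separated for the sup distance
   in the torus R / aZ x R / bZ, and there are at most a b / L^2 of them.

   The two geodesics may run along each other. So B is replaced by the geodesic with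
   one corner joining p to its image by the holonomy of B, for p on no lift of A but
   close to a point B(t0) that lies on no lift of A other than B itself. A lift of A
   different from B meets the new segment only if it already met the old one, and the
   line B meets it at most once; recording a crossing of the latter kind at B(t0)
   keeps the recorded crossings separated. *)
Require Import Defs.
From mathcomp Require Import all_boot all_order all_algebra.
From mathcomp Require Import finmap generic_quotient.
From mathcomp Require Import all_classical all_reals all_analysis.
From mathcomp Require Import zify ring lra.
Import Order.TTheory GRing.Theory Num.Theory numFieldNormedType.Exports.
Local Open Scope classical_set_scope.
Local Open Scope ring_scope.

(** * The hyperboloid model *)

(** In the hyperboloid model points are vectors and [dot] is a Lorentz form, so lines, their sides
    and their tangents are treated by linear algebra, and an isometry enters only through the values
    of [dot] that it preserves.

    The intersection number is an infimum, so one pair of representatives is enough; the obstacle is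
    to make it transversal without adding crossings. A corner of the broken geodesic has in general
    no velocity, hence no lift of A may pass through [p]. Then no lift of A contains a piece either,
    and distinct lines that cross are transversal. Moving the endpoints of the old segment slightly
    creates no crossing with a lift that misses both of them: only finitely many lifts come near,
    and such a crossing is a strict change of sign of a linear form. The choice of t0 leaves the
    lifts along B as the only exceptions. *)

Section Hyperboloid.
Context {R : realType}.
Implicit Types (z x y : hplane R) (s t : R) (u v w : R * R * R).

(* Twice the hyperbolic cosine and sine. *)
Definition ch t : R := expR t + expR (- t).
Definition sh t : R := expR t - expR (- t).

Definition dot u v : R := u.1.1 * v.2 + u.2 * v.1.1 - 2 * u.1.2 * v.1.2.
Definition lin (a : R) u (b : R) v : R * R * R :=
  (a * u.1.1 + b * v.1.1, a * u.1.2 + b * v.1.2, a * u.2 + b * v.2).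

(* [((p, q), r)] stands for the symmetric matrix with rows [(p, q)] and [(q, r)]. The
   half-plane becomes the hyperboloid of positive definite matrices of determinant 1,
   and [dot], twice the polar form of the determinant, becomes [ch] of the distance. *)
Definition mink z : R * R * R :=
  (((set_val z).1 ^+ 2 + (set_val z).2 ^+ 2) / (set_val z).2,
   (set_val z).1 / (set_val z).2, (set_val z).2^-1).

Lemma im_gt0 z : 0 < (set_val z).2.
Proof. by have := set_valP z. Qed.

Lemma mink_r_gt0 z : 0 < (mink z).2.
Proof. by rewrite invr_gt0 im_gt0. Qed.

Lemma dotC u v : dot u v = dot v u.
Proof. rewrite /dot; ring. Qed.

Lemma dot_linl a u b v w : dot (lin a u b v) w = a * dot u w + b * dot v w.
Proof. rewrite /dot /lin /=; ring. Qed.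

Lemma dot_linr a u b v w : dot w (lin a u b v) = a * dot w u + b * dot w v.
Proof. by rewrite dotC dot_linl !(dotC w). Qed.

Lemma dot_mink z (w : hplane R) : dot (mink z) (mink w) =
  2 * (1 + (((set_val z).1 - (set_val w).1) ^+ 2 +
            ((set_val z).2 - (set_val w).2) ^+ 2) /
           (2 * (set_val z).2 * (set_val w).2)).
Proof.
have := im_gt0 z; have := im_gt0 w; rewrite /dot /mink /= => w0 z0.
by field; rewrite !gt_eqF.
Qed.

Lemma dot_mink_ge2 z (w : hplane R) : 2 <= dot (mink z) (mink w).
Proof.
rewrite dot_mink ler_peMr// lerDl divr_ge0//; last first.
  by rewrite !mulr_ge0// ltW// im_gt0.
by rewrite addr_ge0// sqr_ge0.
Qed.

Lemma dot_minkxx z : dot (mink z) (mink z) = 2.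
Proof. by rewrite dot_mink !subrr expr0n /= addr0 mul0r addr0 mulr1. Qed.

Lemma expRN1 t : expR t * expR (- t) = 1.
Proof. by rewrite -expRD subrr expR0. Qed.

Lemma chN t : ch (- t) = ch t.
Proof. by rewrite /ch opprK addrC. Qed.

Lemma ch_abs t : ch `|t| = ch t.
Proof. by case: (ler0P t) => _ //; rewrite chN. Qed.

Lemma ch0 : ch 0 = 2.
Proof. by rewrite /ch oppr0 expR0. Qed.

Lemma ch_gt0 t : 0 < ch t.
Proof. by rewrite addr_gt0// expR_gt0. Qed.

Lemma ler_ch s t : 0 <= s -> 0 <= t -> (ch s <= ch t) = (s <= t).
Proof.
suff mono a b : 0 <= a -> a < b -> ch a < ch b.
  move=> s0 t0; have [st|ts] := leP s t.
    by move: st; rewrite le_eqVlt => /orP[/eqP->|/mono/ltW]; rewrite ?lexx//; exact.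
  by apply/negbTE; rewrite -ltNge mono.
move=> a0 ab; rewrite /ch !expRN.
have ea : 1 <= expR a by rewrite -expR0 ler_expR.
have eab : expR a < expR b by rewrite ltr_expR.
rewrite -subr_gt0.
have -> : expR b + (expR b)^-1 - (expR a + (expR a)^-1) =
  (expR b - expR a) * (1 - (expR a * expR b)^-1).
  by field; rewrite !gt_eqF ?expR_gt0.
rewrite mulr_gt0 ?subr_gt0//.
have e1 : 1 < expR a * expR b by nra.
by rewrite invf_lt1// mulr_gt0 ?expR_gt0.
Qed.

Lemma ch_inj s t : 0 <= s -> 0 <= t -> ch s = ch t -> s = t.
Proof. by move=> s0 t0 e; apply/le_anti; apply/andP; split; rewrite -ler_ch// e. Qed.

Lemma ch_arcosh (c : R) : 1 <= c -> ch (arcosh c) = 2 * c.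
Proof.
move=> c1; rewrite /ch /arcosh.
have sq : Num.sqrt (c ^+ 2 - 1) ^+ 2 = c ^+ 2 - 1.
  by rewrite sqr_sqrtr// subr_ge0 exprn_ege1.
have s0 := sqrtr_ge0 (c ^+ 2 - 1).
rewrite expRN lnK; last by rewrite posrE; lra.
have -> : (c + Num.sqrt (c ^+ 2 - 1))^-1 = c - Num.sqrt (c ^+ 2 - 1).
  apply: (@mulfI _ (c + Num.sqrt (c ^+ 2 - 1))); first by rewrite gt_eqF//; lra.
  rewrite divff ?gt_eqF//; last lra.
  by rewrite mulrC -subr_sqr sq; ring.
ring.
Qed.

Lemma arcosh_ge0 (c : R) : 1 <= c -> 0 <= arcosh c.
Proof.
move=> c1; rewrite ln_ge0//.
by have := sqrtr_ge0 (c ^+ 2 - 1); lra.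
Qed.

Lemma ch_arg_ge1 z (w : hplane R) :
  1 <= 1 + (((set_val z).1 - (set_val w).1) ^+ 2 +
            ((set_val z).2 - (set_val w).2) ^+ 2) /
           (2 * (set_val z).2 * (set_val w).2).
Proof. by have := dot_mink_ge2 z w; rewrite dot_mink; lra. Qed.

Lemma hdist_ge0 z (w : hplane R) : 0 <= hdist z w.
Proof. exact/arcosh_ge0/ch_arg_ge1. Qed.

Lemma ch_hdist z (w : hplane R) : ch (hdist z w) = dot (mink z) (mink w).
Proof. by rewrite ch_arcosh ?ch_arg_ge1// dot_mink. Qed.

Lemma hdistP z (w : hplane R) t : hdist z w = `|t| <-> dot (mink z) (mink w) = ch t.
Proof.
rewrite -ch_hdist -(ch_abs t); split=> [->//|].
by apply: ch_inj; rewrite ?hdist_ge0.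
Qed.

Lemma hdistC z (w : hplane R) : hdist z w = hdist w z.
Proof. by apply: ch_inj; rewrite ?hdist_ge0// !ch_hdist dotC. Qed.

Lemma hdistxx z : hdist z z = 0.
Proof. by rewrite -(normr0 R); apply/hdistP; rewrite dot_minkxx ch0. Qed.

(** For vectors of norm 2 this gives [dot] the sign of the product of the last coordinates: it is
    positive exactly when both lie on the same sheet of the hyperboloid. *)
Lemma dot_sum_squares u v : dot u u = 2 -> dot v v = 2 ->
  u.2 * v.2 * dot u v = u.2 ^+ 2 + v.2 ^+ 2 + (u.1.2 * v.2 - u.2 * v.1.2) ^+ 2.
Proof.
rewrite /dot => u2 v2.
have up : u.1.1 * u.2 = 1 + u.1.2 ^+ 2 by lra.
have vp : v.1.1 * v.2 = 1 + v.1.2 ^+ 2 by lra.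
have -> : u.2 * v.2 * (u.1.1 * v.2 + u.2 * v.1.1 - 2 * u.1.2 * v.1.2) =
  (u.1.1 * u.2) * v.2 ^+ 2 + (v.1.1 * v.2) * u.2 ^+ 2
  - 2 * u.1.2 * v.1.2 * u.2 * v.2 by ring.
by rewrite up vp; ring.
Qed.

(** Eliminating the first coordinates by orthogonality shows that the form is negative definite on
    the tangent space at [x]. *)
Lemma dot_orth x v w : dot (mink x) v = 0 -> dot (mink x) w = 0 ->
  - (dot v w) * (mink x).2 ^+ 2 =
  2 * (v.2 * w.2 + ((mink x).1.2 * v.2 - (mink x).2 * v.1.2) *
                   ((mink x).1.2 * w.2 - (mink x).2 * w.1.2)).
Proof.
have := dot_minkxx x; rewrite /dot; move: (mink x) => u u2 uv uw.
have up : u.1.1 * u.2 = 1 + u.1.2 ^+ 2 by lra.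
have uv' : u.2 * v.1.1 = 2 * u.1.2 * v.1.2 - u.1.1 * v.2 by lra.
have uw' : u.2 * w.1.1 = 2 * u.1.2 * w.1.2 - u.1.1 * w.2 by lra.
have -> : - (v.1.1 * w.2 + v.2 * w.1.1 - 2 * v.1.2 * w.1.2) * u.2 ^+ 2 =
  - w.2 * u.2 * (u.2 * v.1.1) - v.2 * u.2 * (u.2 * w.1.1)
  + 2 * v.1.2 * w.1.2 * u.2 ^+ 2 by ring.
rewrite uv' uw'.
transitivity (- 2 * u.2 * u.1.2 * (w.2 * v.1.2 + v.2 * w.1.2)
  + 2 * v.2 * w.2 * (u.1.1 * u.2) + 2 * v.1.2 * w.1.2 * u.2 ^+ 2).
  by ring.
rewrite up; ring.
Qed.

(** Serves to prove vectors equal: it is enough that their difference is orthogonal to a point of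
    the hyperboloid and not of negative norm. *)
Lemma dot_orth_eq0 x v : dot (mink x) v = 0 -> 0 <= dot v v -> v = (0, 0, 0).
Proof.
move=> xv vv; have := dot_orth _ _ _ xv xv.
have r0 := mink_r_gt0 x; set r := (mink x).2 in r0 *; set q := (mink x).1.2.
have h1 := sqr_ge0 v.2; have h2 := sqr_ge0 (q * v.2 - r * v.1.2).
have h3 : 0 <= dot v v * r ^+ 2 by rewrite mulr_ge0// sqr_ge0.
rewrite mulNr -!expr2 => h.
have /eqP : v.2 ^+ 2 = 0 by lra.
rewrite sqrf_eq0 => /eqP v20.
have /eqP : (q * v.2 - r * v.1.2) ^+ 2 = 0 by lra.
rewrite v20 mulr0 sub0r sqrf_eq0 oppr_eq0 mulf_eq0 gt_eqF//= => /eqP v120.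
move: xv; rewrite /dot v20 v120 !mulr0 subr0 add0r => /eqP.
rewrite mulf_eq0 gt_eqF//= => /eqP v110.
by rewrite [v]surjective_pairing [v.1]surjective_pairing v110 v120 v20.
Qed.

Lemma mink_inj : injective mink.
Proof.
move=> z w; have := im_gt0 z; have := im_gt0 w; rewrite /mink.
move=> w0 z0 [_ e1 /invr_inj e2].
suff : set_val z = set_val w by rewrite !set_valE => /val_inj.
rewrite [LHS]surjective_pairing [RHS]surjective_pairing e2; congr (_, _).
by apply: (@mulIf _ (set_val w).2^-1); rewrite ?invr_eq0 ?gt_eqF// -{1}e2.
Qed.

Lemma mink_onto u : dot u u = 2 -> 0 < u.2 -> exists z, mink z = u.
Proof.
move: u => [[p q] r]; rewrite /dot /= => h r0.
have P : (q / r, r^-1) \in @upper_half_plane R.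
  by rewrite inE /upper_half_plane /= invr_gt0.
exists (SigSub P); rewrite /mink set_valE /= invrK; congr (_, _, _).
  have hh : p * r = 1 + q ^+ 2 by lra.
  apply: (@mulIf _ r); first by rewrite gt_eqF.
  by rewrite hh; field; rewrite gt_eqF.
by rewrite mulfVK// gt_eqF.
Qed.

Lemma mink_onto_dot u x : dot u u = 2 -> 0 < dot u (mink x) ->
  exists z, mink z = u.
Proof.
move=> uu ux; apply: mink_onto => //.
have := dot_sum_squares _ _ uu (dot_minkxx x).
have r0 := mink_r_gt0 x => h.
have : 0 < u.2 * (mink x).2 * dot u (mink x).
  rewrite h; have := sqr_ge0 u.2.
  have := sqr_ge0 (u.1.2 * (mink x).2 - u.2 * (mink x).1.2).
  have : 0 < (mink x).2 ^+ 2 by rewrite exprn_gt0.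
  lra.
by rewrite !pmulr_lgt0.
Qed.

Lemma hdist_eq0 z (w : hplane R) : hdist z w = 0 -> z = w.
Proof.
move=> zw; apply: mink_inj.
have h : dot (mink z) (mink w) = 2 by rewrite -ch_hdist zw ch0.
have := @dot_orth_eq0 z (lin 1 (mink z) (-1) (mink w)).
rewrite !(dot_linl, dot_linr) !dot_minkxx (dotC _ (mink z)) h.
move=> /(_ ltac:(lra) ltac:(lra)).
case: (mink z) (mink w) => [[a b] c] [[a' b'] c'] [/= *].
by congr (_, _, _); lra.
Qed.

Lemma minkE z : mink z =
  (((set_val z).1 ^+ 2 + (set_val z).2 ^+ 2) / (set_val z).2,
   (set_val z).1 / (set_val z).2, (set_val z).2^-1).
Proof. by []. Qed.

End Hyperboloid.

#[global] Opaque mink.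

(** * Geodesic lines *)

Section Geodesics.
Context {R : realType}.
Implicit Types (z x y : hplane R) (s t : R) (u v w : R * R * R).
Implicit Types (c : R -> hplane R).

(** Lagrange's identity in the tangent plane: the Gram determinant is, up to scale, the squared
    determinant in the coordinates (q, r). It yields Cauchy-Schwarz together with its equality
    case. *)
Lemma dot_orth_lagrange x v w : dot (mink x) v = 0 -> dot (mink x) w = 0 ->
  (dot v w) ^+ 2 * (mink x).2 ^+ 2 + 4 * (v.1.2 * w.2 - v.2 * w.1.2) ^+ 2 =
  dot v v * dot w w * (mink x).2 ^+ 2.
Proof.
move=> xv xw; have r0 := mink_r_gt0 x.
apply: (@mulfI _ ((mink x).2 ^+ 2)); first by rewrite gt_eqF// exprn_gt0.
have vw := dot_orth _ _ _ xv xw.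
have vv := dot_orth _ _ _ xv xv.
have ww := dot_orth _ _ _ xw xw.
move: vw vv ww r0; set r := (mink x).2; set q := (mink x).1.2 => vw vv ww r0.
transitivity ((- dot v w * r ^+ 2) ^+ 2
  + 4 * r ^+ 2 * (v.1.2 * w.2 - v.2 * w.1.2) ^+ 2); first by ring.
transitivity ((- dot v v * r ^+ 2) * (- dot w w * r ^+ 2)); last by ring.
rewrite vw vv ww; ring.
Qed.

Lemma dot_orth_CauchySchwarz x v w : dot (mink x) v = 0 -> dot (mink x) w = 0 ->
  dot v w ^+ 2 <= dot v v * dot w w.
Proof.
move=> xv xw; have r0 : 0 < (mink x).2 ^+ 2 by rewrite exprn_gt0// mink_r_gt0.
rewrite -(ler_pM2r r0) -(dot_orth_lagrange _ _ _ xv xw) lerDl.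
by rewrite mulr_ge0// sqr_ge0.
Qed.

Lemma shE s t : sh (s - t) = expR s / expR t - expR t / expR s.
Proof. by rewrite /sh opprB !expRD !expRN. Qed.

Lemma chE s t : ch (s - t) = expR s / expR t + expR t / expR s.
Proof. by rewrite /ch opprB !expRD !expRN. Qed.

Lemma ch_add s t : 2 * ch (s + t) = ch s * ch t + sh s * sh t.
Proof. rewrite /ch /sh opprD !expRD; ring. Qed.

Lemma ch2_sub_sh2 t : ch t ^+ 2 - sh t ^+ 2 = 4.
Proof.
have -> : 4 = 4 * (expR t * expR (- t)) :> R by rewrite expRN1 mulr1.
rewrite /ch /sh; ring.
Qed.

Lemma sh_gt0 t : 0 < t -> 0 < sh t.
Proof. by move=> t0; rewrite subr_gt0 ltr_expR; lra. Qed.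

Lemma shN t : sh (- t) = - sh t.
Proof. by rewrite /sh opprK opprB. Qed.

Lemma sh_eq0 t : (sh t == 0) = (t == 0).
Proof.
apply/eqP/eqP => [h|->]; last by rewrite /sh oppr0 subrr.
case: (ltrgtP t 0) => // t0; last by have := sh_gt0 _ t0; rewrite h ltxx.
have : 0 < - t by rewrite oppr_gt0.
by move/sh_gt0; rewrite shN h oppr0 ltxx.
Qed.

(** The triangle inequality through the hyperbolic law of cosines: [v] and [w] are multiples of the
    directions from [y] to [x] and [z], and Cauchy-Schwarz bounds the cosine of their angle. *)
Lemma dot_chD x y z a b : 0 <= a -> 0 <= b ->
  dot (mink x) (mink y) = ch a -> dot (mink y) (mink z) = ch b ->
  dot (mink x) (mink z) <= ch (a + b).
Proof.
move=> a0 b0 xy yz.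
pose v := lin 2 (mink x) (- ch a) (mink y).
pose w := lin 2 (mink z) (- ch b) (mink y).
have yv : dot (mink y) v = 0.
  by rewrite dot_linr dot_minkxx (dotC (mink y)) xy; ring.
have yw : dot (mink y) w = 0 by rewrite dot_linr dot_minkxx yz; ring.
have vv : dot v v = 2 * (4 - ch a ^+ 2).
  by rewrite /v !(dot_linl, dot_linr) !dot_minkxx (dotC (mink y)) xy; ring.
have ww : dot w w = 2 * (4 - ch b ^+ 2).
  by rewrite /w !(dot_linl, dot_linr) !dot_minkxx (dotC (mink z) (mink y)) yz; ring.
have vw : dot v w = 4 * dot (mink x) (mink z) - 2 * ch a * ch b.
  rewrite /v /w !(dot_linl, dot_linr) !dot_minkxx xy yz; ring.
have := dot_orth_CauchySchwarz _ _ _ yv yw; rewrite vv ww vw => {v w yv yw vv ww vw}.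
have -> : 4 - ch a ^+ 2 = - sh a ^+ 2 by rewrite -(ch2_sub_sh2 a); ring.
have -> : 4 - ch b ^+ 2 = - sh b ^+ 2 by rewrite -(ch2_sub_sh2 b); ring.
have sh0 t : 0 <= t -> 0 <= sh t.
  by rewrite le_eqVlt => /orP[/eqP <-|/sh_gt0/ltW//]; rewrite /sh oppr0 subrr.
have := sh0 _ a0; have := sh0 _ b0; have := ch_add a b.
move: (dot _ _) (ch (a + b)) (ch a) (ch b) (sh a) (sh b) => d e p q r s.
move=> {xy yz sh0} h s0 r0 cs.
have : `|4 * d - 2 * p * q| <= 2 * r * s.
  rewrite -ler_sqr ?nnegrE ?mulr_ge0// real_normK ?num_real//.
  by apply: le_trans cs _; rewrite le_eqVlt; apply/orP; left; apply/eqP; ring.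
move=> /(le_trans (ler_norm _)); lra.
Qed.

Lemma hdist_triangle y x z : hdist x z <= hdist x y + hdist y z.
Proof.
rewrite -ler_ch ?hdist_ge0 ?addr_ge0 ?hdist_ge0// ch_hdist.
by apply: (dot_chD _ y); rewrite ?hdist_ge0 ?ch_hdist.
Qed.

(** The difference [E] of the two sides is orthogonal to [mink x] and null, hence zero. As [t] may
    lie outside the segment, this parametrises the whole line through [x] and [y]. *)
Lemma geodesic_lincomb s0 s1 t x y z : s0 != s1 ->
  hdist x y = `|s0 - s1| -> hdist z x = `|t - s0| -> hdist z y = `|t - s1| ->
  mink z = lin (sh (s1 - t) / sh (s1 - s0)) (mink x)
               (sh (t - s0) / sh (s1 - s0)) (mink y).
Proof.
move=> s01 /hdistP xy /hdistP zx /hdistP zy.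
have : sh (s1 - s0) != 0 by rewrite sh_eq0 subr_eq0 eq_sym.
move: xy zx zy; rewrite !shE !chE => xy zx zy.
have := expR_gt0 t; have := expR_gt0 s0; have := expR_gt0 s1.
move: (expR t) (expR s0) (expR s1) xy zx zy => e a b xy zx zy b0 a0 e0 sn.
have sn' : b * b + - a * a != 0.
  apply: contra_neq sn => h.
  suff -> : b / a - a / b = (b * b + - a * a) / (a * b) by rewrite h mul0r.
  by field; rewrite !gt_eqF.
set E := lin 1 (mink z) (-1) (lin ((b / e - e / b) / (b / a - a / b)) (mink x)
   ((e / a - a / e) / (b / a - a / b)) (mink y)).
have /dot_orth_eq0 : dot (mink x) E = 0.
  rewrite /E !dot_linr (dotC _ (mink z)) dot_minkxx xy zx.
  by field; rewrite sn' (gt_eqF a0) (gt_eqF b0) (gt_eqF e0).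
have -> : dot E E = 0.
  rewrite /E !(dot_linl, dot_linr) !dot_minkxx (dotC (mink y) (mink x))
    (dotC (mink x) (mink z)) (dotC (mink y) (mink z)) xy zx zy.
  by field; rewrite sn' (gt_eqF a0) (gt_eqF b0) (gt_eqF e0).
move=> /(_ (lexx _)); rewrite /E /lin /= => -[].
rewrite !mul1r !mulN1r => /subr0_eq h1 /subr0_eq h2 /subr0_eq h3.
by rewrite [LHS]surjective_pairing [(mink z).1]surjective_pairing h1 h2 h3.
Qed.

Lemma geodesic_uniq s0 s1 t x y z z' : s0 != s1 -> hdist x y = `|s0 - s1| ->
  hdist z x = `|t - s0| -> hdist z y = `|t - s1| ->
  hdist z' x = `|t - s0| -> hdist z' y = `|t - s1| -> z = z'.
Proof.
move=> s01 xy zx zy z'x z'y; apply: mink_inj.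
by rewrite (geodesic_lincomb _ _ _ _ _ _ s01 xy zx zy)
  (geodesic_lincomb _ _ _ _ _ _ s01 xy z'x z'y).
Qed.

Definition gline c := forall s t, hdist (c s) (c t) = `|s - t|.

Lemma gline_inj c : gline c -> injective c.
Proof.
move=> cP s t st; have := cP s t; rewrite st hdistxx => /esym/eqP.
by rewrite normr_eq0 subr_eq0 => /eqP.
Qed.

Lemma iso_uniq c c' s0 s1 t : s0 != s1 ->
  hdist (c s0) (c s1) = `|s0 - s1| ->
  hdist (c t) (c s0) = `|t - s0| -> hdist (c t) (c s1) = `|t - s1| ->
  hdist (c' t) (c' s0) = `|t - s0| -> hdist (c' t) (c' s1) = `|t - s1| ->
  c s0 = c' s0 -> c s1 = c' s1 -> c t = c' t.
Proof.
move=> s01 h0 h1 h2 h3 h4 e0 e1; rewrite -e0 in h3; rewrite -e1 in h4.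
exact: (geodesic_uniq s0 s1 t (c s0) (c s1)).
Qed.

Lemma gline_uniq c c' s0 s1 : gline c -> gline c' -> s0 != s1 ->
  c s0 = c' s0 -> c s1 = c' s1 -> c =1 c'.
Proof. by move=> cP c'P s01 e0 e1 t; apply: (iso_uniq _ _ s0 s1). Qed.

Lemma gline_comp g c : hisometry g -> gline c -> gline (g \o c).
Proof. by move=> gP cP s t /=; rewrite gP. Qed.

Lemma gline_shift c (a b : R) : `|b| = 1 -> gline c ->
  gline (fun t => c (a + b * t)).
Proof.
move=> b1 cP s t; rewrite cP opprD addrACA subrr add0r -mulrBr normrM b1.
by rewrite mul1r.
Qed.

(** The combinations of [geodesic_lincomb] form the line; their product with [mink x] is positive,
    which keeps them on the right sheet. *)
Lemma gline_through x y : x <> y ->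
  exists c, [/\ gline c, c 0 = x & c (hdist x y) = y].
Proof.
move=> xy; set d := hdist x y.
have d0 : d != 0 by apply/eqP => /hdist_eq0.
pose V t := lin (sh (d - t) / sh d) (mink x) (sh t / sh d) (mink y).
have sd : sh d != 0 by rewrite sh_eq0.
have dxy : dot (mink x) (mink y) = ch d by rewrite -ch_hdist.
have dV s t : dot (V s) (V t) = ch (s - t).
  rewrite /V !(dot_linl, dot_linr) !dot_minkxx (dotC (mink y)) dxy.
  move: sd; rewrite !shE !chE /sh /ch !expRN.
  have := expR_gt0 t; have := expR_gt0 s; have := expR_gt0 d.
  move: (expR t) (expR s) (expR d) => e a b b0 a0 e0 sn.
  have sn' : b ^+ 2 - 1 != 0.
    apply: contra_neq sn => h.
    suff -> : b - b^-1 = (b ^+ 2 - 1) / b by rewrite h mul0r.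
    by field; rewrite !gt_eqF.
  by field; rewrite sn' !gt_eqF.
have V0 : V 0 = mink x.
  rewrite /V subr0 divff// [sh 0]/sh oppr0 subrr mul0r /lin !mul1r !mul0r !addr0.
  by rewrite -!surjective_pairing.
have Vd : V d = mink y.
  rewrite /V subrr divff// [sh 0]/sh oppr0 subrr mul0r /lin !mul1r !mul0r !add0r.
  by rewrite -!surjective_pairing.
have /choice[c cP] : forall t, exists z, mink z = V t.
  move=> t; apply: (mink_onto_dot _ x); first by rewrite dV subrr ch0.
  by rewrite -V0 dV ch_gt0.
exists c; split.
- by move=> s t; apply/hdistP; rewrite !cP dV.
- by apply: mink_inj; rewrite cP.
- by apply: mink_inj; rewrite cP.
Qed.

Lemma gline_meet2 c1 c2 s0 s1 t0 t1 : gline c1 -> gline c2 -> s0 != s1 ->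
  c1 s0 = c2 t0 -> c1 s1 = c2 t1 ->
  exists b, `|b| = 1 /\ forall s, c1 s = c2 (t0 + b * (s - s0)).
Proof.
move=> P1 P2 s01 e0 e1.
have tE : `|s1 - s0| = `|t1 - t0| by rewrite -P1 -P2 e0 e1.
have s10 : s1 - s0 != 0 by rewrite subr_eq0 eq_sym.
pose b := (t1 - t0) / (s1 - s0).
have b1 : `|b| = 1 by rewrite normrM normfV -tE divff// normr_eq0.
exists b; split=> // s.
have P2' : gline (fun s => c2 ((t0 - b * s0) + b * s)) by exact: gline_shift.
rewrite (gline_uniq _ _ s0 s1 P1 P2' s01).
- by congr c2; ring.
- by rewrite e0; congr c2; ring.
- rewrite e1; congr c2; rewrite -[LHS](addrNK t0).
  have -> : t1 - t0 = b * (s1 - s0) by rewrite /b divfK.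
  ring.
Qed.

Lemma gline_meet2_range c1 c2 s0 s1 t0 t1 : gline c1 -> gline c2 -> s0 != s1 ->
  c1 s0 = c2 t0 -> c1 s1 = c2 t1 -> range c1 = range c2.
Proof.
move=> P1 P2 s01 e0 e1.
have sub a b (x0 x1 y0 y1 : R) : gline a -> gline b -> x0 != x1 ->
    a x0 = b y0 -> a x1 = b y1 -> range a `<=` range b.
  move=> Pa Pb x01 f0 f1 _ [s _ <-].
  have [k [_ ->]] := gline_meet2 _ _ _ _ _ _ Pa Pb x01 f0 f1.
  by exists (y0 + k * (s - x0)).
apply/seteqP; split; first exact: (sub _ _ s0 s1 t0 t1).
apply: (sub _ _ t0 t1 s0 s1) => //.
by apply: contra_neq s01 => t01; apply: (gline_inj _ P1); rewrite e0 e1 t01.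
Qed.

(** The derivative of [mink (c t)], obtained by solving the formula of [gline_vel] at [u = 1] for
    the tangent vector. *)
Definition vel c t := lin (- ch 1 / sh 1) (mink (c t)) (2 / sh 1) (mink (c (t + 1))).

Lemma sh1_neq0 : sh 1 != 0 :> R.
Proof. by rewrite sh_eq0 oner_eq0. Qed.

Lemma gline_vel c t (u : R) : gline c ->
  mink (c (t + u)) = lin (ch u / 2) (mink (c t)) (sh u / 2) (vel c t).
Proof.
move=> cP; have t1 : t != t + 1 by rewrite lt_eqF// ltrDl.
rewrite (geodesic_lincomb _ _ _ _ _ _ t1 (cP t (t + 1)) (cP (t + u) t)
  (cP (t + u) (t + 1))).
have -> : t + 1 - (t + u) = 1 - u by ring.
have -> : t + 1 - t = 1 by ring.
have -> : t + u - t = u by ring.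
have s1 := sh1_neq0.
have e1 : sh (1 - u) / sh 1 = ch u / 2 - (sh u / 2) * (ch 1 / sh 1).
  have : 2 * sh (1 - u) = sh 1 * ch u - ch 1 * sh u.
    rewrite shE /sh /ch !expRN; field.
    by rewrite !gt_eqF ?expR_gt0.
  move=> h; have -> : sh (1 - u) = (sh 1 * ch u - ch 1 * sh u) / 2 by lra.
  by field.
rewrite e1 /vel /lin /=; congr (_, _, _); field; rewrite ?s1 ?pnatr_eq0//.
Qed.

Lemma dot_vel c t : gline c -> dot (mink (c t)) (vel c t) = 0.
Proof.
move=> cP; rewrite dot_linr dot_minkxx.
have /hdistP -> := cP t (t + 1).
have -> : t - (t + 1) = - 1 by ring.
by rewrite chN; field; rewrite sh1_neq0.
Qed.

Lemma dot_velvel c t : gline c -> dot (vel c t) (vel c t) = - 2.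
Proof.
move=> cP; rewrite /vel !(dot_linr, dot_linl) !dot_minkxx (dotC (mink (c (t + 1)))).
have /hdistP -> := cP t (t + 1).
have -> : t - (t + 1) = - 1 by ring.
have := ch2_sub_sh2 1; have := sh1_neq0; rewrite chN.
move: (sh 1) (ch 1) => a b a0 h.
transitivity (- 2 * (b ^+ 2 - 4) / a ^+ 2); first by field.
have -> : b ^+ 2 - 4 = a ^+ 2 by lra.
by field.
Qed.

(* Velocities are read in the coordinates (q, r), which together with the
   orthogonality to the base point determine a tangent vector. *)
Lemma gline_tangent c1 c2 s t : gline c1 -> gline c2 -> c1 s = c2 t ->
  (vel c1 s).1.2 * (vel c2 t).2 = (vel c1 s).2 * (vel c2 t).1.2 ->
  range c1 = range c2.
Proof.
move=> P1 P2 st e.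
have := dot_vel c1 s P1; have := dot_vel c2 t P2; rewrite -st.
have := dot_velvel c1 s P1; have := dot_velvel c2 t P2.
have := gline_vel c1 s 1 P1; have := gline_vel c2 t 1 P2.
have := gline_vel c2 t (-1) P2; rewrite -st chN shN.
move: (vel c1 s) (vel c2 t) e => v w e m2 m2' m1 ww vv xw xv.
(* Parallel tangents are the equality case, so their product is 2 or -2; both have norm -2, so they
   are opposite or equal. *)
have := dot_orth_lagrange _ _ _ xv xw.
rewrite e subrr expr0n /= mulr0 addr0 vv ww => /mulIf.
rewrite gt_eqF ?exprn_gt0 ?mink_r_gt0// => /(_ isT) h.
have : (dot v w - 2) * (dot v w + 2) = 0.
  by transitivity (dot v w ^+ 2 - -2 * -2); [ring | rewrite h subrr].
move/eqP; rewrite mulf_eq0 => /orP[]; rewrite (subr_eq0, addr_eq0) => /eqP vwE.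
- have /dot_orth_eq0 : dot (mink (c1 s)) (lin 1 v 1 w) = 0.
    by rewrite dot_linr xv xw; ring.
  rewrite !(dot_linr, dot_linl) (dotC w v) vv ww vwE => /(_ ltac:(lra)).
  rewrite /lin => -[]; rewrite !mul1r => h1 h2 h3.
  apply: (gline_meet2_range _ _ s (s + 1) t (t - 1)) => //.
    by rewrite lt_eqF// ltrDl.
  apply: mink_inj; rewrite m1 m2 /lin; congr (_, _, _).
  + have -> : v.1.1 = - w.1.1 by lra.
    ring.
  + have -> : v.1.2 = - w.1.2 by lra.
    ring.
  + have -> : v.2 = - w.2 by lra.
    ring.
- have /dot_orth_eq0 : dot (mink (c1 s)) (lin 1 v (-1) w) = 0.
    by rewrite dot_linr xv xw; ring.
  rewrite !(dot_linr, dot_linl) (dotC w v) vv ww vwE => /(_ ltac:(lra)).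
  rewrite /lin => -[]; rewrite !mul1r => h1 h2 h3.
  apply: (gline_meet2_range _ _ s (s + 1) t (t + 1)) => //.
    by rewrite lt_eqF// ltrDl.
  apply: mink_inj; rewrite m1 m2' /lin; congr (_, _, _).
  + have -> : v.1.1 = w.1.1 by lra.
    ring.
  + have -> : v.1.2 = w.1.2 by lra.
    ring.
  + have -> : v.2 = w.2 by lra.
    ring.
Qed.

(* Up to scale, the linear form vanishing on the plane that cuts out the line. *)
Definition side c u : R :=
  let x := mink (c 0) in let v := vel c 0 in
  u.1.1 * (x.1.2 * v.2 - x.2 * v.1.2) + u.1.2 * (x.2 * v.1.1 - x.1.1 * v.2)
  + u.2 * (x.1.1 * v.1.2 - x.1.2 * v.1.1).

Lemma side_lin c (a b : R) u v : side c (lin a u b v) = a * side c u + b * side c v.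
Proof. rewrite /side /lin /=; ring. Qed.

(** A vanishing determinant puts [mink z] in the span of [mink (c 0)] and [vel c 0]; its norm then
    places it on the branch of hyperbola traced by [c]. *)
Lemma side_eq0 c z : gline c -> side c (mink z) = 0 <-> range c z.
Proof.
move=> cP; split; last first.
  move=> [t _ <-]; rewrite -(add0r t) (gline_vel _ _ _ cP) side_lin.
  rewrite /side; ring.
move=> sz; have := dot_vel c 0 cP; have := dot_velvel c 0 cP.
have := gline_vel c 0 _ cP; move: sz; rewrite /side.
move: (vel c 0) => v sz cv vv xv.
pose a := dot (mink (c 0)) (mink z); pose b := dot v (mink z).
(* Twice the component of [mink z] orthogonal to [mink (c 0)] and [v]. The determinant makes it
   parallel to [v] as well, hence zero. *)
pose E := lin 2 (mink z) (-1) (lin a (mink (c 0)) (- b) v).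
have xE : dot (mink (c 0)) E = 0.
  rewrite /E !dot_linr dot_minkxx xv -/a; ring.
have vE : dot v E = 0.
  rewrite /E !dot_linr vv (dotC v (mink (c 0))) xv -/b; ring.
have key : v.1.2 * E.2 - v.2 * E.1.2 = 0.
  have : (mink (c 0)).2 * (v.1.1 * ((mink (c 0)).1.2 * E.2 - (mink (c 0)).2 * E.1.2)
      + v.1.2 * ((mink (c 0)).2 * E.1.1 - (mink (c 0)).1.1 * E.2)
      + v.2 * ((mink (c 0)).1.1 * E.1.2 - (mink (c 0)).1.2 * E.1.1)) = 0.
    rewrite /E /lin /=; move: sz.
    move: (mink (c 0)) (mink z) => x y sz.
    transitivity (- 2 * x.2 * (y.1.1 * (x.1.2 * v.2 - x.2 * v.1.2) +
      y.1.2 * (x.2 * v.1.1 - x.1.1 * v.2) +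
      y.2 * (x.1.1 * v.1.2 - x.1.2 * v.1.1))); first by ring.
    by rewrite sz mulr0.
  have := dot_minkxx (c 0); move: xE xv; rewrite /dot.
  move: (mink (c 0)) E {vE} => x E xE xv xx k.
  have e1 : x.2 * v.1.1 = 2 * x.1.2 * v.1.2 - x.1.1 * v.2 by lra.
  have e2 : x.2 * E.1.1 = 2 * x.1.2 * E.1.2 - x.1.1 * E.2 by lra.
  have e3 : x.1.1 * x.2 = 1 + x.1.2 ^+ 2 by lra.
  have : - 2 * (v.1.2 * E.2 - v.2 * E.1.2) = 0; last by lra.
  rewrite -[RHS]k.
  transitivity (x.2 * v.1.1 * (x.1.2 * E.2 - x.2 * E.1.2)
      + v.1.2 * (x.2 * (x.2 * E.1.1) - x.1.1 * x.2 * E.2)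
      + v.2 * (x.1.1 * x.2 * E.1.2 - x.1.2 * (x.2 * E.1.1))); last by ring.
  rewrite e1 e2 mulrBr.
  transitivity (- (x.1.1 * x.2 - x.1.2 ^+ 2) * 2 * (v.1.2 * E.2 - v.2 * E.1.2)).
    by rewrite e3; ring.
  ring.
have E0 : E = (0, 0, 0).
  apply: (dot_orth_eq0 _ _ xE).
  have := dot_orth_lagrange _ _ _ xv xE; rewrite key vE vv expr0n /= mulr0 mul0r addr0.
  move=> /esym/eqP; rewrite -mulrA mulf_eq0 oppr_eq0 pnatr_eq0 /= mulf_eq0.
  by rewrite [_ ^+ 2 == 0]gt_eqF ?exprn_gt0 ?mink_r_gt0// orbF => /eqP ->.
have ab : (a - b) * (a + b) = 4.
  have : dot E E = 8 - 2 * ((a - b) * (a + b)).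
    rewrite /E !(dot_linr, dot_linl) !dot_minkxx vv (dotC v (mink (c 0))) xv.
    rewrite (dotC (mink z) (mink (c 0))) (dotC (mink z) v) -/a -/b.
    ring.
  rewrite E0 /dot /= !mulr0 addr0 subr0; move: ((a - b) * (a + b)) => k; lra.
move: E0; rewrite /E /lin => -[] h1 h2 h3.
have a2 : 2 <= a := dot_mink_ge2 _ _.
have e1 : 0 < (a - b) / 2.
  rewrite divr_gt0// ltNge; apply/negP => ab0.
  have : 0 < a + b by lra.
  by move: ab; nra.
(* At the parameter sought, [ch] is [a] and [sh] is [- b], and their sum is twice the
   exponential. *)
exists (ln ((a - b) / 2)) => //.
have et : expR (ln ((a - b) / 2)) = (a - b) / 2 by rewrite lnK ?posrE.
have et' : expR (- ln ((a - b) / 2)) = (a + b) / 2.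
  rewrite expRN et.
  apply: (@mulfI _ ((a - b) / 2)); first by rewrite gt_eqF.
  rewrite divff ?gt_eqF//.
  by transitivity ((a - b) * (a + b) / 4); [rewrite ab divff| field].
apply: mink_inj; rewrite -(add0r (ln ((a - b) / 2))) cv.
have -> : ch (ln ((a - b) / 2)) = a by rewrite /ch et et'; field.
have -> : sh (ln ((a - b) / 2)) = - b by rewrite /sh et et'; field.
rewrite /lin [RHS]surjective_pairing [(mink z).1]surjective_pairing.
by congr (_, _, _); lra.
Qed.

End Geodesics.

(** * Topology and velocities *)

Section Topology.
Context {R : realType}.
Implicit Types (z w x y : hplane R) (s t : R) (u v : R * R * R).
Implicit Types (c : R -> hplane R).

Lemma set_val_minkE z :
  set_val z = ((mink z).1.2 / (mink z).2, (mink z).2^-1).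
Proof.
rewrite minkE /= invrK divfK ?gt_eqF ?im_gt0//.
exact: surjective_pairing.
Qed.

Lemma set_val_continuous : continuous (set_val : hplane R -> R * R).
Proof. exact: initial_continuous. Qed.

Lemma re_continuous : continuous (fun z : hplane R => (set_val z).1).
Proof. by move=> z; apply: continuous_comp (set_val_continuous z) _; exact: cvg_fst. Qed.

Lemma im_continuous : continuous (fun z : hplane R => (set_val z).2).
Proof. by move=> z; apply: continuous_comp (set_val_continuous z) _; exact: cvg_snd. Qed.

Lemma mink_r_continuous : continuous (fun z : hplane R => (mink z).2).
Proof.
move=> z; rewrite /continuous_at.
under eq_fun do rewrite minkE /=; rewrite minkE /=.
exact: (cvgV (lt0r_neq0 (im_gt0 z)) (im_continuous z)).
Qed.

Lemma mink_q_continuous : continuous (fun z : hplane R => (mink z).1.2).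
Proof.
move=> z; rewrite /continuous_at.
under eq_fun do rewrite minkE /=; rewrite minkE /=.
exact: (cvgM (re_continuous z) (cvgV (lt0r_neq0 (im_gt0 z)) (im_continuous z))).
Qed.

Lemma mink_p_continuous : continuous (fun z : hplane R => (mink z).1.1).
Proof.
move=> z; rewrite /continuous_at.
under eq_fun do rewrite minkE /= !expr2; rewrite minkE /= !expr2.
exact: (cvgM (cvgD (cvgM (re_continuous z) (re_continuous z))
                   (cvgM (im_continuous z) (im_continuous z)))
             (cvgV (lt0r_neq0 (im_gt0 z)) (im_continuous z))).
Qed.

Lemma linear_mink_continuous (a b d : R) :
  continuous (fun z : hplane R => (mink z).1.1 * a + (mink z).1.2 * b + (mink z).2 * d).
Proof.
move=> z; exact: (cvgD (cvgD (cvgM (mink_p_continuous z) (cvg_cst a))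
  (cvgM (mink_q_continuous z) (cvg_cst b))) (cvgM (mink_r_continuous z) (cvg_cst d))).
Qed.

Lemma side_continuous c : continuous (fun z : hplane R => side c (mink z)).
Proof. exact: linear_mink_continuous. Qed.

Lemma dot_continuous z : continuous (fun w : hplane R => dot (mink z) (mink w)).
Proof.
move=> x; have := linear_mink_continuous (mink z).2 (- 2 * (mink z).1.2) (mink z).1.1 x.
rewrite /continuous_at.
have E w : dot (mink z) (mink w) = (mink w).1.1 * (mink z).2 +
   (mink w).1.2 * (-2 * (mink z).1.2) + (mink w).2 * (mink z).1.1.
  rewrite /dot; ring.
by under [X in _ -> X @ _ --> _]eq_fun do rewrite E; rewrite E.
Qed.

Lemma hball_open z (e : R) : open [set w | hdist z w < e].
Proof.
have [e0|e0] := leP 0 e; last first.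
  rewrite (_ : mkset _ = set0); first exact: open0.
  by apply/seteqP; split => // w /=; have := hdist_ge0 z w; lra.
rewrite (_ : mkset _ = (fun w => dot (mink z) (mink w)) @^-1` [set x | x < ch e]).
  apply: open_comp; last exact: open_lt.
  by move=> ? _; exact: dot_continuous.
by apply/seteqP; split => w /=; rewrite -ch_hdist !ltNge ler_ch// hdist_ge0.
Qed.

Lemma nbhs_hball z (e : R) : 0 < e -> nbhs z [set w | hdist z w < e].
Proof.
move=> e0; apply: open_nbhs_nbhs; split; first exact: hball_open.
by rewrite /= hdistxx.
Qed.

Lemma hdist_euclid z x :
  (dot (mink z) (mink x) - 2) * ((set_val z).2 * (set_val x).2) =
  ((set_val z).1 - (set_val x).1) ^+ 2 + ((set_val z).2 - (set_val x).2) ^+ 2.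
Proof.
rewrite dot_mink; field.
by rewrite !gt_eqF ?im_gt0.
Qed.

(** Together with [hball_open], this identifies the topology inherited from the Euclidean plane with
    that of [hdist]. *)
Lemma hdist_nbhs z (U : set (hplane R)) : nbhs z U ->
  exists2 e : R, 0 < e & forall w, hdist z w < e -> U w.
Proof.
move=> [_ [/= [W oW <-] Wz] sWU].
have /nbhs_ballP[e /= e0 eW] : nbhs (set_val z) W by exact: open_nbhs_nbhs.
have y0 := im_gt0 z; set y := (set_val z).2 in y0.
(* The bound 1/4 keeps the height of [w] at most [4 * y]; the squared Euclidean distance is then
   below [8 * eta * y ^ 2], which the second bound makes at most half of [e ^ 2]. *)
pose eta := Num.min 4^-1 (e ^+ 2 / (16 * y ^+ 2)).
have eta0 : 0 < eta.
  by rewrite lt_min invr_gt0 ltr0n divr_gt0// ?mulr_gt0// exprn_gt0.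
have eta1 : eta <= 4^-1 by rewrite ge_min lexx.
have eta2 : eta <= e ^+ 2 / (16 * y ^+ 2) by rewrite ge_min lexx orbT.
have chd : ch (arcosh (1 + eta)) = 2 * (1 + eta) by rewrite ch_arcosh//; lra.
have d0 : 0 <= arcosh (1 + eta) by apply: arcosh_ge0; lra.
exists (arcosh (1 + eta)).
  rewrite lt_neqAle d0 andbT; apply/eqP => h; move: chd; rewrite -h ch0; lra.
move=> w; rewrite ltNge -ler_ch ?hdist_ge0// chd ch_hdist -ltNge => h.
apply: sWU => /=; apply: eW.
have := hdist_euclid z w; rewrite -/y.
have := im_gt0 w.
move: (set_val z) (set_val w) @y y0 @eta eta0 eta1 eta2 {chd d0} h.
move=> [a b] [a' b'] /= b0; move: (dot _ _) (Num.min _ _) => D k k0 k1 k2 h b'0.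
move=> E.
have E' : (a - a') ^+ 2 + (b - b') ^+ 2 < 2 * k * (b * b').
  rewrite -E ltr_pM2r ?mulr_gt0//; lra.
have b4 : b' <= 4 * b.
  rewrite leNgt; apply/negP => lt.
  have : (b - b') ^+ 2 < 2^-1 * (b * b').
    apply: le_lt_trans (_ : (a - a') ^+ 2 + (b - b') ^+ 2 < _).
      by rewrite lerDr sqr_ge0.
    apply: lt_le_trans E' _; rewrite ler_pM2r ?mulr_gt0//; lra.
  nra.
have E2 : (a - a') ^+ 2 + (b - b') ^+ 2 < e ^+ 2.
  apply: lt_le_trans E' _.
  have : k * (16 * b ^+ 2) <= e ^+ 2 by rewrite -ler_pdivlMr// mulr_gt0// exprn_gt0.
  nra.
have ltE (q : R) : q ^+ 2 < e ^+ 2 -> `|q| < e.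
  by rewrite -[q ^+ 2]real_normK ?num_real// ltr_sqr// nnegrE// ltW.
split; rewrite /ball /=; apply: ltE; apply: le_lt_trans E2.
  by rewrite lerDl sqr_ge0.
by rewrite lerDr sqr_ge0.
Qed.

Lemma hplane_cvgP (T : topologicalType) (f : T -> hplane R) (F : set_system T) z :
  Filter F -> (forall e : R, 0 < e -> \forall x \near F, hdist z (f x) < e) ->
  f @ F --> z.
Proof.
move=> FF fz U /hdist_nbhs[e e0 eU]; apply: filterS (fz e e0) => x; exact: eU.
Qed.

Lemma hdist_lipschitz z x y : `|hdist z x - hdist z y| <= hdist x y.
Proof.
rewrite ler_norml; have := hdist_triangle x z y; have := hdist_triangle y z x.
by rewrite (hdistC y x) => *; apply/andP; split; lra.
Qed.

Lemma gline_continuous c : gline c -> continuous c.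
Proof.
move=> cP t; apply: hplane_cvgP => e e0; near=> s; rewrite cP; near: s.
exact: (@cvgr_dist_lt _ R^o).
Unshelve. all: by end_near. Qed.

(** Total, so that coordinates can be given by formulas without a proof of positivity; the default
    is the point i. *)
Definition mkh (p : R * R) : hplane R :=
  if pselect (upper_half_plane p) is left h then SigSub (mem_set h)
  else SigSub (mem_set (ltr01 : @upper_half_plane R (0, 1))).

Lemma set_val_mkh (p : R * R) : 0 < p.2 -> set_val (mkh p) = p.
Proof. by rewrite /mkh; case: pselect => // h _; rewrite set_valE. Qed.

Lemma mkh_continuous (T : topologicalType) (f g : T -> R) (t : T) :
  (forall i : T, 0 < g i) ->
  {for t, continuous f} -> {for t, continuous g} ->
  {for t, continuous (fun i : T => mkh (f i, g i))}.
Proof.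
move=> g0 cf cg U [_ [/= [W oW <-] Wt] sWU].
move: Wt => /=; rewrite set_val_mkh//= => Wt.
have : nbhs (f t, g t) W by exact: open_nbhs_nbhs.
move/(cvg_pair cf cg) => nW.
have : nbhs t [set i | W (f i, g i)] by exact: nW.
apply: filterS => x Wx; apply: sWU => /=.
by rewrite set_val_mkh; [exact: Wx|exact: g0].
Qed.

(** The ball is closed and lies in a rectangle whose heights are at least [m]. Cutting heights off
    below at [m] makes the rectangle the image of a compact set under a map [f] continuous on the
    whole plane. *)
Lemma hball_compact z (e : R) : compact [set w | hdist z w <= e].
Proof.
have [e0|e0] := leP 0 e; last first.
  rewrite (_ : mkset _ = set0); first exact: compact0.
  by apply/seteqP; split => // w /=; have := hdist_ge0 z w; lra.
set a := (set_val z).1; set b := (set_val z).2.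
have b0 : 0 < b := im_gt0 z.
pose K := ch e / 2.
have K1 : 1 <= K.
  have : ch 0 <= ch e by rewrite ler_ch.
  by rewrite ch0 /K; lra.
pose m := b / (2 * K); have m0 : 0 < m by rewrite divr_gt0//; lra.
pose f (p : R * R) := mkh (p.1, Num.max p.2 m).
have cf : continuous f.
  move=> p; apply: mkh_continuous.
  - by move=> x; rewrite lt_max m0 orbT.
  - exact: cvg_fst.
  - apply: max_fun_continuous => //.
      by move=> ?; exact: cvg_snd.
    by move=> ?; exact: cvg_cst.
have Kc : compact (f @` (`[a - 2 * b * K, a + 2 * b * K] `*` `[m, 2 * b * K])).
  apply: continuous_compact; first exact: continuous_subspaceT.
  by apply: compact_setX; exact: segment_compact.
apply: subclosed_compact Kc _.
  rewrite (_ : mkset _ = (fun w => dot (mink z) (mink w)) @^-1` [set x | x <= ch e]).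
    apply: preimage_closed; last exact: closed_le.
    by move=> ? _; exact: dot_continuous.
  by apply/seteqP; split => w /=; rewrite -ch_hdist ler_ch// hdist_ge0.
move=> w /=; rewrite -ler_ch ?hdist_ge0// ch_hdist => h.
have := hdist_euclid z w; rewrite -/a -/b.
have b'0 := im_gt0 w.
move=> E.
have eK : ch e = 2 * K by rewrite /K; field.
have E' : (a - (set_val w).1) ^+ 2 + (b - (set_val w).2) ^+ 2
    <= 2 * (K - 1) * (b * (set_val w).2).
  rewrite -E ler_pM2r ?mulr_gt0//; rewrite eK in h; lra.
have s1 := sqr_ge0 (a - (set_val w).1); have s2 := sqr_ge0 (b - (set_val w).2).
have h1 : (set_val w).2 <= 2 * b * K.
  rewrite -(ler_pM2r b'0); nra.
have h2 : m <= (set_val w).2.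
  rewrite /m ler_pdivrMr ?mulr_gt0//; last lra.
  rewrite -(ler_pM2r b0); nra.
exists (set_val w); last first.
  rewrite /f max_l//; apply: val_inj; rewrite -!set_valE set_val_mkh//=.
  by rewrite -surjective_pairing.
split; rewrite /= in_itv /= ?h1 ?h2//.
have : `|a - (set_val w).1| <= 2 * b * K.
  have B0 : 0 <= 2 * b * K by rewrite !mulr_ge0//; lra.
  rewrite -ler_sqr ?nnegrE// real_normK ?num_real//.
  nra.
by rewrite ler_norml => /andP[? ?]; apply/andP; split; lra.
Qed.

Lemma mink_gline_derive c t : gline c ->
  is_derive t 1 (fun s => (mink (c s)).1.2) (vel c t).1.2 /\
  is_derive t 1 (fun s => (mink (c s)).2) (vel c t).2.
Proof.
move=> cP.
have E s : mink (c s) = lin (ch (s - t) / 2) (mink (c t)) (sh (s - t) / 2) (vel c t).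
  by rewrite -gline_vel// addrC subrK.
have D (a b : R) : is_derive t 1 (fun s => ch (s - t) / 2 * a + sh (s - t) / 2 * b) b.
  have E2 : (fun s => ch (s - t) / 2 * a + sh (s - t) / 2 * b) =
     (fun s => (expR (s - t) + expR (- (s - t))) / 2 * a
             + (expR (s - t) - expR (- (s - t))) / 2 * b) by [].
  rewrite E2; apply: is_derive_eq.
  rewrite subrr oppr0 expR0 /GRing.scale /=. 
  by field.
have E1 : (fun s => (mink (c s)).1.2) =
    (fun s => ch (s - t) / 2 * (mink (c t)).1.2 + sh (s - t) / 2 * (vel c t).1.2).
  by apply/funext => s; rewrite E.
have E2 : (fun s => (mink (c s)).2) =
    (fun s => ch (s - t) / 2 * (mink (c t)).2 + sh (s - t) / 2 * (vel c t).2).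
  by apply/funext => s; rewrite E.
by rewrite E1 E2; split; exact: D.
Qed.

(** The quotient rule applied to the half-plane coordinates q / r and 1 / r. *)
Definition velocity c t : R * R :=
  (((vel c t).1.2 * (mink (c t)).2 - (mink (c t)).1.2 * (vel c t).2)
     / (mink (c t)).2 ^+ 2,
   - (vel c t).2 / (mink (c t)).2 ^+ 2).

Lemma gline_derive c t : gline c ->
  is_derive t 1 (fun s => (set_val (c s)).1) (velocity c t).1 /\
  is_derive t 1 (fun s => (set_val (c s)).2) (velocity c t).2.
Proof.
move=> cP; have [dq dr] := mink_gline_derive c t cP.
have r0 : (mink (c t)).2 != 0 by rewrite gt_eqF// mink_r_gt0.
have dV := @is_deriveV _ (fun s => (mink (c s)).2) t _ _ r0 dr.
have -> : (fun s => (set_val (c s)).1) =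
    (fun s => (mink (c s)).1.2) * (fun s => (mink (c s)).2^-1).
  by apply/funext => s; rewrite set_val_minkE.
have -> : (fun s => (set_val (c s)).2) = (fun s => (mink (c s)).2^-1).
  by apply/funext => s; rewrite set_val_minkE.
split.
  apply: is_derive_eq (is_deriveM dq dV) _.
  rewrite /velocity /GRing.scale; move: (vel c t) (mink (c t)) r0 => u x r0 /=.
  by field.
apply: is_derive_eq dV _.
rewrite /velocity /GRing.scale; move: (vel c t) (mink (c t)) r0 => u x r0 /=.
by field.
Qed.

Lemma gline_affine_derive c (k m t : R) : gline c ->
  is_derive t 1 (fun s => (set_val (c (k + m * s))).1) (m * (velocity c (k + m * t)).1) /\
  is_derive t 1 (fun s => (set_val (c (k + m * s))).2) (m * (velocity c (k + m * t)).2).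
Proof.
move=> cP; have [dx dy] := gline_derive c (k + m * t) cP.
have da : is_derive t 1 (fun s : R => k + m * s) m.
  by apply: is_derive_eq; rewrite /GRing.scale /=; ring.
rewrite -(mulrC _.1) -(mulrC _.2); split.
  exact: (@is_derive1_comp _ (fun s => (set_val (c s)).1) (fun s => k + m * s)).
exact: (@is_derive1_comp _ (fun s => (set_val (c s)).2) (fun s => k + m * s)).
Qed.

(** Passing from (q, r) to (q / r, 1 / r) multiplies determinants of tangent vectors by -1 / r^3, so
    parallel velocities would make the lines tangent. *)
Lemma velocity_transversal c1 c2 s t : gline c1 -> gline c2 -> c1 s = c2 t ->
  range c1 <> range c2 ->
  (velocity c1 s).1 * (velocity c2 t).2 - (velocity c1 s).2 * (velocity c2 t).1 != 0.
Proof.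
move=> P1 P2 st; apply: contra_notN => /eqP h; apply: (gline_tangent _ _ s t) => //.
move: h; rewrite /velocity -st.
have := mink_r_gt0 (c1 s).
move: (mink (c1 s)) (vel _ _) (vel _ _) => x u v r0 /= h.
apply/eqP; rewrite -subr_eq0.
have /eqP : (v.1.2 * u.2 - v.2 * u.1.2) / x.2 ^+ 3 = 0.
  by rewrite -[RHS]oppr0 -h; field; rewrite gt_eqF.
by rewrite mulf_eq0 invr_eq0 [_ ^+ 3 == 0]gt_eqF ?exprn_gt0// orbF.
Qed.

End Topology.

(** * Deck transformations and the systole *)

Section Surface.
Context {R : realType} (X : hyperbolic_surface R).
Implicit Types (z w x y : hplane R) (s t : R) (c : R -> hplane R).
Implicit Types (g h : hplane R -> hplane R).

Lemma projP z w :
  surface_proj X z = surface_proj X w <-> exists2 g, deck X g & g z = w.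
Proof.
split=> [e|gz].
  have /eqmodP/asboolP := e; exact.
by apply/eqmodP/asboolP.
Qed.

Lemma proj_deck g z : deck X g -> surface_proj X (g z) = surface_proj X z.
Proof. by move=> gX; apply/esym/projP; exists g. Qed.

Lemma proj_surj p : exists z, surface_proj X z = p.
Proof. by exists (repr p); rewrite /surface_proj reprK. Qed.

Lemma surface_proj_continuous : continuous (surface_proj X).
Proof. exact: pi_continuous. Qed.

Lemma deck_uniq g h z : deck X g -> deck X h -> g z = h z -> g = h.
Proof.
move=> gX hX ghz; have [k kX [hk kh]] := deck_inv hX.
have kg : k \o g = id.
  by apply: (deck_free (z := z) (deck_comp kX gX)); rewrite /= ghz hk.
by apply/funext => x; rewrite -[LHS]kh -[k _]/((k \o g) x) kg.
Qed.

Lemma deck_finite z (r : R) : finite_set [set g | deck X g /\ hdist z (g z) <= r].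
Proof.
have [r0|r0] := leP 0 r; last first.
  rewrite (_ : mkset _ = set0); first exact: finite_set0.
  by apply/seteqP; split => // g /= [_]; have := hdist_ge0 z (g z); lra.
apply: sub_finite_set (deck_properly_discontinuous X (hball_compact z r)).
move=> g [gX gz]; split=> //; exists (g z); split=> //.
by exists z => //=; rewrite hdistxx.
Qed.

(** Pigeonhole along infinitely many times, used to find one deck transformation or one line that
    serves at two of them. *)
Lemma finite_collision {T : Type} (F : set T) (f : R -> T) (a b : R) : a < b ->
  finite_set F -> (forall t, a < t < b -> F (f t)) ->
  exists s t, [/\ a < s < b, a < t < b, s != t & f s = f t].
Proof.
move=> ab Ffin fF.
pose u (n : nat) := a + (b - a) / n.+2%:R.
have uP n : a < u n < b.
  rewrite /u ltrDl divr_gt0 ?subr_gt0//= -ltrBrDl ltr_pdivrMr//.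
  by rewrite -[ltLHS]mulr1 ltr_pM2l ?subr_gt0// ltr1n.
have uI : injective u.
  move=> m n /addrI/mulfI; rewrite subr_eq0 gt_eqF// => /(_ isT)/invr_inj/eqP.
  by rewrite eqr_nat => /eqP[].
apply: contrapT => none; apply: infinite_nat.
have -> : [set: nat] = (f \o u) @^-1` F.
  by apply/seteqP; split => // n _; exact: fF.
apply: finite_preimage Ffin => m n _ _ fmn; apply: contrapT => mn.
apply: none; exists (u m), (u n); split=> //.
by apply/eqP => /uI.
Qed.

Definition iso_on (a b : R) c := forall s t, a < s < b -> a < t < b ->
  hdist (c s) (c t) = `|s - t|.

Lemma gline_iso_on (a b : R) c : gline c -> iso_on a b c.
Proof. by move=> cP s t _ _; exact: cP. Qed.

Lemma iso_on_uniq (a b : R) c c' s0 s1 t : iso_on a b c -> iso_on a b c' ->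
  a < s0 < b -> a < s1 < b -> s0 != s1 -> c s0 = c' s0 -> c s1 = c' s1 ->
  a < t < b -> c t = c' t.
Proof. by move=> cP c'P h0 h1 s01 e0 e1 ht; apply: (iso_uniq _ _ s0 s1); auto. Qed.

Lemma iso_on_comp (a b : R) g c : hisometry g -> iso_on a b c -> iso_on a b (g \o c).
Proof. by move=> gP cP s t sab tab /=; rewrite gP cP. Qed.

(** Each time [t] has its own deck transformation from [c t] to [c' t]. All of them displace [c m]
    by at most [r], so they are finitely many, one serves two times, and isometric arcs that agree
    twice agree throughout. *)
Lemma lift_uniq (a b : R) c c' : a < b -> iso_on a b c -> iso_on a b c' ->
  (forall t, a < t < b -> surface_proj X (c t) = surface_proj X (c' t)) ->
  exists2 g, deck X g & forall t, a < t < b -> c' t = g (c t).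
Proof.
move=> ab cP c'P cc'.
have /choice[gam gamP] : forall t, exists g, deck X g /\ (a < t < b -> g (c t) = c' t).
  move=> t; case: (pselect (a < t < b)) => [tab|tab].
    by have /projP[g gX gE] := cc' _ tab; exists g.
  by exists id; split=> //; exact: deck_id.
pose m := (a + b) / 2.
have mab : a < m < b by rewrite /m; apply/andP; split; lra.
pose r := hdist (c m) (c' m) + 2 * (b - a).
have [|s [t [sab tab st est]]] :=
    @finite_collision _ _ gam a b ab (deck_finite (c m) r).
  move=> t tab; have [gX gE] := gamP t; split=> //.
  have gE' := gE tab; have gi := deck_isometry gX.
  have h1 := hdist_triangle (c' m) (c m) (gam t (c m)).
  have h2 := hdist_triangle (c' t) (c' m) (gam t (c m)).
  have h4 : hdist (c' t) (gam t (c m)) = `|t - m| by rewrite -gE' gi cP.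
  rewrite h4 c'P// distrC in h2.
  have h3 : `|m - t| < b - a by rewrite /m ltr_norml; apply/andP; split; lra.
  rewrite distrC in h3; rewrite /r; lra.
have [gX gE] := gamP s; exists (gam s) => // x xab.
apply: (iso_on_uniq a b c' (gam s \o c) s t) => //.
- exact: iso_on_comp (deck_isometry gX) cP.
- by rewrite /= gE.
- by have [_ <-//] := gamP t; rewrite /= est.
Qed.

(** Unique continuation: near one time the local lift and the line differ by a deck transformation,
    and two common points extend this relation to the whole interval. *)
Lemma proj_near (a b : R) c c' (f : R -> points X) : a < b ->
  iso_on a b c -> (forall t, a < t < b -> f t = surface_proj X (c t)) ->
  gline c' -> (exists2 t, a < t < b & \forall s \near t, f s = surface_proj X (c' s)) ->
  forall t, a < t < b -> f t = surface_proj X (c' t).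
Proof.
move=> ab cP fc c'P [t tab /nbhs_ballP[e /= e0 te]].
pose l := Num.max a (t - e); pose u := Num.min b (t + e).
have lu : l < u.
  case/andP: tab => ta tb; rewrite /l /u lt_min !gt_max.
  by repeat (apply/andP; split); lra.
have sub s : l < s < u -> (a < s < b) /\ ball t e s.
  rewrite gt_max lt_min => /andP[/andP[-> h1] /andP[-> h2]]; split => //.
  by rewrite /ball /= ltr_norml; apply/andP; split; lra.
have [|||g gX gE] := @lift_uniq l u c c' lu.
- by move=> x y /sub[xab _] /sub[yab _]; exact: cP.
- exact: gline_iso_on.
- by move=> s /sub[sab /te <-]; rewrite fc.
move=> s sab; rewrite fc// -(proj_deck g _ gX).
have lab : a <= l by rewrite le_max lexx.
have uab : u <= b by rewrite ge_min lexx.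
congr (surface_proj X _); symmetry.
pose s0 := l + (u - l) / 3; pose s1 := l + 2 * (u - l) / 3.
have h0 : l < s0 < u by rewrite /s0; apply/andP; split; lra.
have h1 : l < s1 < u by rewrite /s1; apply/andP; split; lra.
apply: (iso_on_uniq a b c' (g \o c) s0 s1) => //; rewrite ?gE//.
- exact: iso_on_comp (deck_isometry gX) cP.
- by have [] := sub _ h0.
- by have [] := sub _ h1.
- by rewrite lt_eqF// /s0 /s1; lra.
Qed.

Lemma gline_of_iso (a b : R) c : a < b -> iso_on a b c ->
  exists2 c', gline c' & forall t, a < t < b -> c t = c' t.
Proof.
move=> ab cP; pose s0 := a + (b - a) / 3; pose s1 := a + 2 * (b - a) / 3.
have h0 : a < s0 < b by rewrite /s0; apply/andP; split; lra.
have h1 : a < s1 < b by rewrite /s1; apply/andP; split; lra.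
have s01 : 0 < s1 - s0 by rewrite /s0 /s1; lra.
have D : hdist (c s0) (c s1) = s1 - s0.
  by rewrite cP// distrC gtr0_norm.
have [|k [kP k0 k1]] := gline_through (c s0) (c s1).
  by move=> e; move: D; rewrite e hdistxx; lra.
have k'P : gline (fun t => k (- s0 + 1 * t)) by apply: gline_shift; rewrite ?normr1.
exists (fun t => k (- s0 + 1 * t)) => // t tab.
apply: (iso_on_uniq a b c (fun t => k (- s0 + 1 * t)) s0 s1) => //.
- by rewrite lt_eqF//; lra.
- by rewrite mul1r addNr k0.
- by rewrite mul1r addrC -D k1.
Qed.

(* The line extending the germ of a lift at 0 projects to [f] on an open set, which is
   also closed because two local lifts of [f] agree up to a deck transformation. *)
Lemma local_geodesic_lift (f : R -> points X) :
  (forall t, exists e : R, exists c : R -> hplane R,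
    [/\ 0 < e,
        {in `]t - e, t + e[, forall s, f s = surface_proj X (c s)} &
        {in `]t - e, t + e[ &, forall s s', hdist (c s) (c s') = `|s - s'|}]) ->
  exists2 c, gline c & forall t, f t = surface_proj X (c t).
Proof.
move=> floc.
have {}floc t : exists e : R, exists c, [/\ 0 < e, iso_on (t - e) (t + e) c &
    forall s, t - e < s < t + e -> f s = surface_proj X (c s)].
  have [e [c [e0 fc cP]]] := floc t; exists e, c; split=> //.
have [e0 [c0 [e00 c0P fc0]]] := floc 0.
have [|c cP c0c] := @gline_of_iso (0 - e0) (0 + e0) c0 _ c0P; first lra.
exists c => //.
pose S : set R := [set t : R | \forall s \near t, f s = surface_proj X (c s)].
suff ST : S = setT.
  by move=> t; have : S t by [rewrite ST]; exact: nbhs_singleton.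
have /connected_intervalP Rc : is_interval [set: R] by [].
have near0 (t e : R) : 0 < e ->
    (forall s, t - e < s < t + e -> f s = surface_proj X (c s)) -> S t.
  move=> ep h; apply/nbhs_ballP; exists e => //= s.
  by rewrite /ball /= ltr_norml => /andP[? ?]; apply: h; apply/andP; split; lra.
apply: Rc.
- by exists 0; apply: (near0 0 e0) => // s h; rewrite fc0// c0c.
- exists S; last by rewrite setTI.
  exact: open_interior.
- exists S; last by rewrite setTI.
  move=> t St.
  have [e [c1 [ep c1P fc1]]] := floc t.
  apply: (near0 t e) => //.
  apply: (proj_near _ _ c1) => //; first lra.
  have [s [Ss ts]] := St _ (nbhsx_ballx t e ep).
  exists s => //.
  by move: ts; rewrite /ball /= ltr_norml => /andP[? ?]; apply/andP; split; lra.
Qed.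

(** Shifting a lift by one period gives another lift; the deck transformation between the two is the
    holonomy. *)
Lemma closed_geodesic_lift (alpha : closed_geodesic X) : exists A g,
  [/\ gline A, deck X g,
      forall t, geodesic_map alpha t = surface_proj X (A t) &
      forall t, A (t + geodesic_length alpha) = g (A t)].
Proof.
have [A AP fA] := local_geodesic_lift _ (geodesic_local alpha).
pose a := geodesic_length alpha.
have A'P : gline (fun t => A (a + 1 * t)) by apply: gline_shift; rewrite ?normr1.
have [|||g gX gE] := @lift_uniq 0 1 A (fun t => A (a + 1 * t)) ltr01.
- exact: gline_iso_on.
- exact: gline_iso_on.
- by move=> t _; rewrite -!fA mul1r addrC geodesic_periodic.
exists A, g; split=> // t.
have -> : t + geodesic_length alpha = a + 1 * t by rewrite mul1r addrC.
apply: (gline_uniq _ (g \o A) 3^-1 2^-1 A'P (gline_comp _ _ (deck_isometry gX) AP)).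
- by rewrite lt_eqF//; lra.
- by apply: gE; apply/andP; split; lra.
- by apply: gE; apply/andP; split; lra.
Qed.

(** The images of the balls of integer radius about [z0] are an increasing open cover of the
    quotient, so one of them is everything. *)
Lemma compact_cobounded z0 : compact [set: points X] ->
  exists r, forall z, exists2 g, deck X g & hdist z0 (g z) < r.
Proof.
move=> /compact_near_coveringP cX.
pose P (n : nat) (p : points X) := exists2 z, surface_proj X z = p & hdist z0 z < n%:R.
have Po n : open (P n).
  have : open (surface_proj X @^-1` P n); last exact.
  have -> : surface_proj X @^-1` P n =
      \bigcup_(g in deck X) [set z | hdist (g z0) z < n%:R].
    apply/seteqP; split => z /=.
      move=> [w /projP[g gX gw] zw]; exists g => //=.
      by rewrite -gw (deck_isometry gX).
    move=> [g gX /= gz]; have [k kX [gk kg]] := deck_inv gX.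
    exists (k z); first exact: proj_deck.
    by rewrite -(deck_isometry gX) kg.
  by apply: bigcup_open => g _; exact: hball_open.
have [|n _ /(_ n (leqnn n)) /= nP] := cX nat \oo P _.
  move=> p _; have [z zp] := proj_surj p.
  pose N := (Num.truncn (hdist z0 z)).+1.
  exists (P N, [set n | (N <= n)%N]) => /=.
    split; last exact: nbhs_infty_ge.
    apply: open_nbhs_nbhs; split; first exact: Po.
    exists z => //; exact: truncnS_gt.
  move=> [q n] /= [[w wq wN] Nn]; exists w => //.
  by apply: lt_le_trans wN _; rewrite ler_nat.
exists n%:R => z; have [//|w /projP[g gX gw] zw] := nP (surface_proj X z).
have [k kX [gk kg]] := deck_inv gX.
by exists k => //; rewrite -gw gk.
Qed.

Lemma displacement_continuous g : hisometry g ->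
  continuous (fun z => hdist z (g z)).
Proof.
move=> gi z.
apply/(@cvgrPdist_lt _ R^o (hplane R) (nbhs (z : hplane R)) (nbhs_filter _)) => e e0.
near=> w.
have h : hdist z w < e / 2 by near: w; apply: nbhs_hball; lra.
have h1 := hdist_lipschitz (g z) z w.
have h2 := hdist_lipschitz w (g z) (g w).
rewrite (hdistC _ z) (hdistC _ w) in h1; rewrite gi in h2.
rewrite -(subrK (hdist w (g z)) (hdist z (g z))) -addrA.
by apply: le_lt_trans (ler_normD _ _) _; lra.
Unshelve. all: by end_near. Qed.

(* Conjugating by deck transformations brings the displaced point into a compact set,
   where only finitely many deck transformations compete. *)
Lemma min_displacement h1 : compact [set: points X] -> deck X h1 -> h1 <> id ->
  exists h z0, [/\ deck X h, h <> id &
    forall g z, deck X g -> g <> id -> hdist z0 (h z0) <= hdist z (g z)].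
Proof.
move=> cX h1X h1I; pose z0 : hplane R := mkh (0, 1).
have [r rP] := compact_cobounded z0 cX.
pose D := hdist z0 (h1 z0).
(* A competitor of displacement at most [D] at a point that is then brought within [r] of [z0] has a
   conjugate displacing [z0] by at most [D + 2 * r]. *)
pose F := [set g | (deck X g /\ hdist z0 (g z0) <= D + 2 * r) /\ g <> id].
have Ffin : finite_set F.
  by apply: sub_finite_set (deck_finite z0 (D + 2 * r)) => g [].
have r0 : 0 <= r.
  by have [g _ /ltW] := rP z0; apply: le_trans; exact: hdist_ge0.
have F1 : F h1 by split=> //; split=> //; rewrite /D; lra.
pose K := [set w | hdist z0 w <= r].
have Kz0 : K z0 by rewrite /K /= hdistxx.
have /choice[m mP] : forall g, exists w, deck X g ->
    K w /\ forall z, K z -> hdist w (g w) <= hdist z (g z).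
  move=> g; case: (pselect (deck X g)) => [gX|]; last by exists z0.
  have [||w /set_mem Kw wP] :=
    @compact_EVT_min _ R (fun z => hdist z (g z)) K _ (hball_compact z0 r).
  - by exists z0.
  - by apply: continuous_subspaceT; exact: displacement_continuous (deck_isometry gX).
  - by exists w => _; split=> // z Kz; apply: wP; exact: mem_set.
pose V := (fun g => hdist (m g) (g (m g))) @` F.
have [|||v /set_mem[h Fh hv] vP] := @compact_EVT_min _ R id V _ _ _.
- by exists (hdist (m h1) (h1 (m h1))); exists h1.
- by apply: finite_compact; exact: finite_image.
- by apply: continuous_subspaceT => x; exact: cvg_id.
have [[hX _] hI] := Fh.
exists h, (m h); split=> // g z gX gI; rewrite hv.
have vF k : F k -> v <= hdist (m k) (k (m k)).
  by move=> Fk; apply: vP; apply: mem_set; exists k.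
have [gD|/ltW gD] := leP (hdist z (g z)) D; last first.
  apply: le_trans gD; apply: le_trans (vF _ F1) _.
  by have [_] := mP _ h1X; exact.
have [k kX kz] := rP z; have [k' k'X [kk' k'k]] := deck_inv kX.
have gX' : deck X (k \o g \o k').
  exact: (deck_comp (deck_comp kX gX) k'X).
have gk : (k \o g \o k') (k z) = k (g z) by rewrite /= kk'.
have dk : hdist (k z) ((k \o g \o k') (k z)) = hdist z (g z).
  by rewrite gk (deck_isometry kX).
have [_ mk] := mP _ gX'.
rewrite -dk; apply: le_trans (mk (k z) (ltW kz)); apply: vF; split; last first.
  move=> e; apply: gI; apply: (deck_free gX (z := z)).
  by apply: (can_inj kk'); rewrite -gk e.
split=> //.
have t1 := hdist_triangle (k z) z0 ((k \o g \o k') z0).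
have t2 := hdist_triangle ((k \o g \o k') (k z)) (k z) ((k \o g \o k') z0).
rewrite dk (deck_isometry gX') (hdistC _ z0) in t2.
move: t1 t2 kz gD; move: (hdist _ _) (hdist _ _) (hdist _ _) (hdist _ _) => *; lra.
Qed.

(** At a point of least displacement, the segment from [z0] to [h z0] and its image meet without a
    corner, so [h] translates the line containing them, and this axis closes up in the quotient. *)
Lemma min_displacement_geodesic h z0 : deck X h -> h <> id ->
  (forall z, hdist z0 (h z0) <= hdist z (h z)) ->
  exists gam : closed_geodesic X, geodesic_length gam = hdist z0 (h z0).
Proof.
move=> hX hI hmin; set d := hdist z0 (h z0).
have zh : z0 <> h z0 by move=> e; apply: hI; exact: (deck_free hX (esym e)).
have d0 : 0 < d.
  by rewrite lt_neqAle hdist_ge0 andbT; apply/eqP => /esym/hdist_eq0.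
have hi := deck_isometry hX.
have [c [cP c0 cd]] := gline_through _ _ zh; rewrite -/d in cd.
(* The midpoint is displaced by exactly [d], which by the triangle equality
   forces its image to lie on the same geodesic. *)
have cm : h (c (d / 2)) = c (3 * d / 2).
  have D1 : hdist (h (c (d / 2))) (c d) = d / 2.
    by rewrite cd hi -c0 cP subr0 gtr0_norm// divr_gt0.
  have D2 : hdist (h (c (d / 2))) (c (d / 2)) = d.
    apply/le_anti/andP; split; last by rewrite hdistC; exact: hmin.
    apply: le_trans (hdist_triangle (c d) _ _) _; rewrite D1 cP.
    by rewrite gtr0_norm; lra.
  apply: (geodesic_uniq (d / 2) d (3 * d / 2) (c (d / 2)) (c d)).
  - by rewrite lt_eqF//; lra.
  - exact: cP.
  - by rewrite D2 gtr0_norm; lra.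
  - by rewrite D1 gtr0_norm; lra.
  - exact: cP.
  - exact: cP.
have c'P : gline (fun t => c (d + 1 * t)) by apply: gline_shift; rewrite ?normr1.
have hc t : c (t + d) = h (c t).
  rewrite addrC -{1}[t]mul1r.
  apply: (gline_uniq _ (h \o c) 0 (d / 2) c'P (gline_comp _ _ hi cP)).
  - by rewrite lt_eqF// divr_gt0.
  - by rewrite mulr0 addr0 cd /= c0.
  - by rewrite /= cm; congr c; field.
have per t : surface_proj X (c (t + d)) = surface_proj X (c t).
  by rewrite hc proj_deck.
have loc t : exists e : R, exists c' : R -> hplane R,
    [/\ 0 < e,
        {in `]t - e, t + e[, forall s, surface_proj X (c s) = surface_proj X (c' s)} &
        {in `]t - e, t + e[ &, forall s s', hdist (c' s) (c' s') = `|s - s'|}].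
  by exists 1, c; split=> // s s' _ _; exact: cP.
by exists (ClosedGeodesic d0 per loc).
Qed.

Lemma closed_geodesic_deck_neq_id (alpha : closed_geodesic X) c g : gline c ->
  (forall t, c (t + geodesic_length alpha) = g (c t)) -> g <> id.
Proof.
move=> cP cg e; have := geodesic_length_gt0 alpha.
by have := cg 0; rewrite e add0r => /(gline_inj _ cP) ->; rewrite ltxx.
Qed.

Lemma systole_le_length (alpha : closed_geodesic X) :
  systole X <= geodesic_length alpha.
Proof.
apply: ge_inf; last by exists alpha.
by exists 0 => _ [gam _ <-]; exact/ltW/geodesic_length_gt0.
Qed.

(** The least displacement is the length of a closed geodesic and bounds all lengths from below, a
    period of a lift being a displacement. [alpha] supplies a nontrivial deck transformation. *)
Lemma systole_displacement (alpha : closed_geodesic X) :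
  compact [set: points X] ->
  0 < systole X /\ forall g z, deck X g -> g <> id -> systole X <= hdist z (g z).
Proof.
move=> cX; have [A [g [AP gX _ Ag]]] := closed_geodesic_lift alpha.
have [h [z0 [hX hI hmin]]] :=
  min_displacement g cX gX (closed_geodesic_deck_neq_id _ _ _ AP Ag).
have [gam gamE] := min_displacement_geodesic h z0 hX hI (fun z => hmin h z hX hI).
split; last first.
  move=> k z kX kI; apply: le_trans (hmin k z kX kI).
  by rewrite -gamE; exact: systole_le_length.
apply: (@lt_le_trans _ _ (hdist z0 (h z0))).
  by rewrite -gamE geodesic_length_gt0.
apply: lb_le_inf; first by exists (geodesic_length alpha), alpha.
move=> _ [b _ <-]; have [B [k [BP kX _ Bk]]] := closed_geodesic_lift b.
apply: le_trans (hmin k (B 0) kX (closed_geodesic_deck_neq_id _ _ _ BP Bk)) _.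
by rewrite -Bk BP sub0r add0r normrN gtr0_norm// geodesic_length_gt0.
Qed.

End Surface.

(** * Homotopies *)

Section Interpolation.
Context {R : realType}.
Implicit Types (z w x y : hplane R) (s t : R) (c : R -> hplane R).
Implicit Types (g h : hplane R -> hplane R).

Definition chord s x y := lin (1 - s) (mink x) s (mink y).

Definition chord_norm s x y :=
  Num.sqrt ((chord s x y).1.1 * (chord s x y).2 - (chord s x y).1.2 ^+ 2).

(* The radial projection to the hyperboloid of a point of the affine segment;
   unlike the arc-length parametrisation it is manifestly continuous. *)
Definition interp s x y : hplane R :=
  mkh ((chord s x y).1.2 / (chord s x y).2, chord_norm s x y / (chord s x y).2).

Lemma chord_dot s x y : 0 <= s <= 1 -> 2 <= dot (chord s x y) (chord s x y).
Proof.
move=> /andP[s0 s1].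
rewrite /chord !(dot_linl, dot_linr) !dot_minkxx (dotC (mink y)).
have := dot_mink_ge2 x y; move: (dot _ _) => d d2.
have : 0 <= s * (1 - s) * (d - 2) by rewrite !mulr_ge0// subr_ge0.
lra.
Qed.

Lemma chord_r_gt0 s x y : 0 <= s <= 1 -> 0 < (chord s x y).2.
Proof.
move=> /andP[s0 s1]; rewrite /chord /=.
have := mink_r_gt0 x; have := mink_r_gt0 y; nra.
Qed.

Lemma chord_normE s x y : 0 <= s <= 1 ->
  0 < chord_norm s x y /\ 2 * chord_norm s x y ^+ 2 = dot (chord s x y) (chord s x y).
Proof.
move=> s01; have := chord_dot s x y s01; rewrite /chord_norm /dot.
move: (chord s x y) => u h.
have e : u.1.1 * u.2 + u.2 * u.1.1 - 2 * u.1.2 * u.1.2 =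
    2 * (u.1.1 * u.2 - u.1.2 ^+ 2) by ring.
rewrite e in h *.
have h0 : 0 < u.1.1 * u.2 - u.1.2 ^+ 2 by lra.
by rewrite sqrtr_gt0 h0 sqr_sqrtr ?ltW.
Qed.

Lemma mink_interp s x y : 0 <= s <= 1 ->
  mink (interp s x y) =
  lin ((1 - s) / chord_norm s x y) (mink x) (s / chord_norm s x y) (mink y).
Proof.
move=> s01; have [n0 nE] := chord_normE s x y s01.
have r0 := chord_r_gt0 s x y s01.
have -> : lin ((1 - s) / chord_norm s x y) (mink x) (s / chord_norm s x y) (mink y) =
    lin (chord_norm s x y)^-1 (chord s x y) 0 (mink x).
  by rewrite /chord /lin /=; congr (_, _, _); ring.
have [||z zE] := mink_onto (lin (chord_norm s x y)^-1 (chord s x y) 0 (mink x)).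
- move: nE n0; move: (chord s x y) (chord_norm s x y) => u n nE n0.
  by rewrite !(dot_linl, dot_linr) -nE; field; rewrite gt_eqF.
- by rewrite /= mul0r addr0 mulr_gt0// invr_gt0.
rewrite -zE; congr mink; apply: val_inj; rewrite -!set_valE.
rewrite set_val_mkh /=; last by rewrite divr_gt0.
rewrite set_val_minkE zE /=.
by congr (_, _); field; rewrite !gt_eqF.
Qed.

Lemma interp0 x y : interp 0 x y = x.
Proof.
have h : (0 : R) <= (0 : R) <= (1 : R) by rewrite lexx ler01.
have [n0 nE] := chord_normE 0 x y h.
have n1 : chord_norm 0 x y = 1.
  apply/eqP; rewrite -(@eqrXn2 _ 2)// ?ltW// expr1n; apply/eqP.
  have : 2 * chord_norm 0 x y ^+ 2 = 2; last by lra.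
  rewrite nE /chord !(dot_linl, dot_linr) !dot_minkxx; ring.
apply: mink_inj; rewrite mink_interp// n1 /lin [RHS]surjective_pairing.
by rewrite [(mink x).1]surjective_pairing /=; congr (_, _, _); field.
Qed.

Lemma interp1 x y : interp 1 x y = y.
Proof.
have h : (0 : R) <= (1 : R) <= (1 : R) by rewrite ler01 lexx.
have [n0 nE] := chord_normE 1 x y h.
have n1 : chord_norm 1 x y = 1.
  apply/eqP; rewrite -(@eqrXn2 _ 2)// ?ltW// expr1n; apply/eqP.
  have : 2 * chord_norm 1 x y ^+ 2 = 2; last by lra.
  rewrite nE /chord !(dot_linl, dot_linr) !dot_minkxx; ring.
apply: mink_inj; rewrite mink_interp// n1 /lin [RHS]surjective_pairing.
by rewrite [(mink y).1]surjective_pairing /=; congr (_, _, _); field.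
Qed.

Lemma dot_isometry g x y : hisometry g ->
  dot (mink (g x)) (mink (g y)) = dot (mink x) (mink y).
Proof. by move=> gi; rewrite -!ch_hdist gi. Qed.

(** [g] is known only to preserve distances, so equality is shown as a vanishing distance: pairing
    with [z] expands linearly in the endpoints, and each term is preserved. *)
Lemma interp_isometry g h s x y : hisometry g -> cancel h g -> 0 <= s <= 1 ->
  g (interp s x y) = interp s (g x) (g y).
Proof.
move=> gi hg s01; set z := interp s (g x) (g y).
have nE : chord_norm s (g x) (g y) = chord_norm s x y.
  have [n0 e] := chord_normE s x y s01; have [n0' e'] := chord_normE s (g x) (g y) s01.
  apply/eqP; rewrite -(@eqrXn2 _ 2)// ?ltW//; apply/eqP.
  have : dot (chord s (g x) (g y)) (chord s (g x) (g y)) =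
         dot (chord s x y) (chord s x y).
    by rewrite /chord !(dot_linl, dot_linr) !dot_isometry.
  by rewrite -e -e' => /mulfI; apply; rewrite pnatr_eq0.
apply: hdist_eq0; rewrite -(normr0 R); apply/hdistP; rewrite ch0.
have zz : (1 - s) / chord_norm s x y * dot (mink (g x)) (mink z)
    + s / chord_norm s x y * dot (mink (g y)) (mink z) = 2.
  by rewrite -(dot_minkxx z) {3}/z mink_interp// dot_linl nE.
rewrite -(hg z) !dot_isometry// in zz.
by rewrite -(hg z) dot_isometry// mink_interp// dot_linl.
Qed.

Lemma interp_continuous (T : topologicalType) (f : T -> R) (a b : T -> hplane R)
    (i : T) : (forall j : T, 0 <= f j <= 1) ->
  {for i, continuous f} -> {for i, continuous a} -> {for i, continuous b} ->
  {for i, continuous (fun j : T => interp (f j) (a j) (b j))}.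
Proof.
move=> f01 cf ca cb.
have C (F : hplane R -> R) : continuous F ->
    {for i, continuous (fun j : T => (1 - f j) * F (a j) + f j * F (b j))}.
  move=> cF; have Fa : {for i, continuous (F \o a)} by apply: continuous_comp ca (cF _).
  have Fb : {for i, continuous (F \o b)} by apply: continuous_comp cb (cF _).
  apply: cvgD; apply: cvgM; [apply: cvgB; [exact: cvg_cst|exact: cf]|exact: Fa|
    exact: cf|exact: Fb].
have Cp := C _ mink_p_continuous; have Cq := C _ mink_q_continuous.
have Cr := C _ mink_r_continuous.
have r0 j := chord_r_gt0 (f j) (a j) (b j) (f01 j).
have Vr : {for i, continuous (fun j : T => (chord (f j) (a j) (b j)).2^-1)}.
  by apply: cvgV; [exact: lt0r_neq0|exact: Cr].
apply: mkh_continuous.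
- by move=> j; rewrite divr_gt0//; have [] := chord_normE (f j) (a j) (b j) (f01 j).
- apply: cvgM; [exact: Cq|exact: Vr].
- have D : {for i, continuous (fun j : T => (chord (f j) (a j) (b j)).1.1 *
     (chord (f j) (a j) (b j)).2 - (chord (f j) (a j) (b j)).1.2 ^+ 2)}.
    apply: cvgB; first by apply: cvgM; [exact: Cp|exact: Cr].
    by apply: cvgM; exact: Cq.
  apply: cvgM; last exact: Vr.
  by apply: continuous_comp D _; exact: sqrt_continuous.
Qed.

(** Interpolation between the lifts commutes with their common holonomy, so each intermediate curve
    projects to a loop. *)
Lemma equivariant_freely_homotopic (X : hyperbolic_surface R) g (b0 b1 : R -> hplane R) :
  deck X g -> continuous b0 -> continuous b1 ->
  (forall t, b0 (t + 1) = g (b0 t)) -> (forall t, b1 (t + 1) = g (b1 t)) ->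
  freely_homotopic (surface_proj X \o b0) (surface_proj X \o b1).
Proof.
move=> gX c0 c1 g0 g1; have gi := deck_isometry gX; have [h _ [_ hg]] := deck_inv gX.
(* [interp] is controlled for parameters in [0, 1] only; clamping makes the homotopy continuous on
   the whole plane. *)
pose clamp s : R := Num.max 0 (Num.min s 1).
have clamp01 s : 0 <= clamp s <= 1.
  by rewrite /clamp le_max lexx /= ge_max ler01 ge_min lexx orbT.
exists (fun p => surface_proj X (interp (clamp p.1) (b0 p.2) (b1 p.2))); split.
- apply: continuous_subspaceT => p.
  apply: (@continuous_comp _ _ _ (fun p : R * R => interp (clamp p.1) (b0 p.2) (b1 p.2))
    (surface_proj X)); last exact: surface_proj_continuous.
  apply: interp_continuous.
  + by move=> q; exact: clamp01.
  + apply: max_fun_continuous => [q|].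
      exact: cvg_cst.
    apply: min_fun_continuous => q; [exact: cvg_fst|exact: cvg_cst].
  + by apply: continuous_comp (c0 _); exact: cvg_snd.
  + by apply: continuous_comp (c1 _); exact: cvg_snd.
- move=> s _ t /=; rewrite g0 g1 -(interp_isometry g h)//; exact: proj_deck.
- by move=> t /=; rewrite /clamp min_l ?ler01// max_l// interp0.
- by move=> t /=; rewrite /clamp minxx max_r ?ler01// interp1.
Qed.

End Interpolation.

(** * Packing squares in a torus *)

Section Packing.
Context {R : realType}.
Implicit Types (x y a L : R) (N m : nat).

(* The circle of length [a] is divided into [N] equal steps; this is the label of the
   [k]-th grid point following [x]. *)
Definition grid N a x (k : nat) : int := ((Num.floor (N%:R * x / a) + k%:Z) %% N%:Z)%Z.

Lemma grid_lt N a x k : (0 < N)%N -> (`|grid N a x k| < N)%N.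
Proof.
move=> N0; rewrite -ltz_nat /grid gez0_abs ?modz_ge0 ?ltz_pmod//; lia.
Qed.

(** Floors lose less than 1 and [k], [l] are at most [m - 1], so points with a common label differ,
    modulo [a], by less than [m] steps of length [a / N]. *)
Lemma grid_near N a x y k l m L : (0 < N)%N -> 0 < a -> (k < m)%N -> (l < m)%N ->
  m%:R <= N%:R * L / a -> grid N a x k = grid N a y l ->
  exists z : int, `|x - y - z%:~R * a| < L.
Proof.
move=> N0 a0 km lm mL /eqP; rewrite eqz_mod_dvd => /dvdzP[z zE].
exists z.
have fx := floor_itv (N%:R * x / a); have fy := floor_itv (N%:R * y / a).
move: fx fy zE; set u := Num.floor _; set v := Num.floor _ => /andP[u1 u2] /andP[v1 v2] zE.
have N0' : 0 < N%:R :> R by rewrite ltr0n.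
have zR : u%:~R + k%:R - (v%:~R + l%:R) = z%:~R * N%:R :> R.
  have := congr1 (fun i : int => i%:~R : R) zE.
  by rewrite /= intrM intrB !intrD !pmulrn.
rewrite !intrD in u2 v2.
have k1 : k%:R + 1 <= m%:R :> R by rewrite natr1 ler_nat.
have l1 : l%:R + 1 <= m%:R :> R by rewrite natr1 ler_nat.
have k0 : 0 <= k%:R :> R by []. have l0 : 0 <= l%:R :> R by [].
have : `|N%:R * x / a - N%:R * y / a - z%:~R * N%:R| < N%:R * L / a.
  by rewrite -zR ltr_norml; apply/andP; split; lra.
have -> : N%:R * x / a - N%:R * y / a - z%:~R * N%:R =
   (x - y - z%:~R * a) * (N%:R / a) by field; rewrite gt_eqF.
by rewrite mulrAC mulrC normrM (gtr0_norm (divr_gt0 N0' a0)) ltr_pM2l// divr_gt0.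
Qed.

Lemma grid_inj N a x k l m : (0 < N)%N -> (k < m)%N -> (l < m)%N -> (m <= N)%N ->
  grid N a x k = grid N a x l -> k = l.
Proof.
move=> N0 km lm mN /eqP; rewrite eqz_mod_dvd => /dvdzP[z zE].
have e : k%:Z - l%:Z = z * N%:Z by lia.
have : z = 0 by nia.
by move=> z0; move: e; rewrite z0 mul0r; lia.
Qed.

(* About [(N L / a) (N L / b)] points of an [N] x [N] grid lie in the square of side [L]
   following each of the [n] points, and these squares are disjoint. *)
Lemma torus_packing (n : nat) (u v : 'I_n -> R) (a b L : R) :
  0 < L -> L <= a -> L <= b ->
  (forall i j (k l : int), `|u i - u j - k%:~R * a| < L ->
     `|v i - v j - l%:~R * b| < L -> i = j) ->
  n%:R * L ^+ 2 <= a * b.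
Proof.
move=> L0 La Lb sep.
have a0 : 0 < a by lra. have b0 : 0 < b by lra.
pose p := L / a; pose q := L / b.
have p0 : 0 < p by rewrite divr_gt0. have q0 : 0 < q by rewrite divr_gt0.
have p1 : p <= 1 by rewrite ler_pdivrMr ?mul1r.
have q1 : q <= 1 by rewrite ler_pdivrMr ?mul1r.
suff : n%:R * (p * q) <= 1.
  have -> : p * q = L ^+ 2 / (a * b) by rewrite /p /q; field; rewrite !gt_eqF.
  by rewrite mulrA ler_pdivrMr ?mul1r// mulr_gt0.
rewrite leNgt; apply/negP => npq.
(* Makes [N * p] and [N * q] at least 1, and [N] so large that the quadratic excess
   [(n * p * q - 1) * N ^ 2] beats the rounding loss, at most [2 * n * N]. *)
pose r := 1 + p^-1 + q^-1 + 2 * n%:R / (n%:R * (p * q) - 1).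
pose N := (Num.truncn r).+1.
have rN : r < N%:R := truncnS_gt r.
have pi : 0 < p^-1 by rewrite invr_gt0. have qi : 0 < q^-1 by rewrite invr_gt0.
have ti : 0 <= 2 * n%:R / (n%:R * (p * q) - 1) by rewrite divr_ge0 ?mulr_ge0//; lra.
have N0' : 0 < N%:R :> R by rewrite ltr0n.
pose ma := Num.truncn (N%:R * p); pose mb := Num.truncn (N%:R * q).
have /andP[ma1 ma2] : ma%:R <= N%:R * p < ma.+1%:R.
  by apply: truncn_itv; rewrite mulr_ge0 ?ltW.
have /andP[mb1 mb2] : mb%:R <= N%:R * q < mb.+1%:R.
  by apply: truncn_itv; rewrite mulr_ge0 ?ltW.
have maN : (ma <= N)%N.
  by rewrite -(ler_nat R); apply: le_trans ma1 _; rewrite ler_piMr// ltW.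
have mbN : (mb <= N)%N.
  by rewrite -(ler_nat R); apply: le_trans mb1 _; rewrite ler_piMr// ltW.
have Ngt0 : (0 < N)%N by [].
pose f (t : 'I_n * 'I_ma * 'I_mb) : 'I_N * 'I_N :=
  (Ordinal (grid_lt N a (u t.1.1) t.1.2 Ngt0), Ordinal (grid_lt N b (v t.1.1) t.2 Ngt0)).
have absI (x y : R) (k l : nat) c : `|grid N c x k|%N = `|grid N c y l|%N ->
    grid N c x k = grid N c y l.
  move=> e; rewrite -[LHS]gez0_abs ?modz_ge0 ?eqz_nat//.
  by rewrite -[RHS]gez0_abs ?modz_ge0 ?eqz_nat// e.
have finj : injective f.
  move=> [[i k] l] [[j k'] l'] /= [/absI ea /absI eb].
  have [z zL] : exists z : int, `|u i - u j - z%:~R * a| < L.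
    by apply: (grid_near N a _ _ k k' ma); rewrite ?ltn_ord// -mulrA.
  have [w wL] : exists w : int, `|v i - v j - w%:~R * b| < L.
    by apply: (grid_near N b _ _ l l' mb); rewrite ?ltn_ord// -mulrA.
  have ij := sep _ _ _ _ zL wL; subst j.
  have /val_inj -> : k = k' :> nat by apply: (grid_inj N a (u i) _ _ ma).
  by have /val_inj -> : l = l' :> nat by apply: (grid_inj N b (v i) _ _ mb).
have : (n * ma * mb <= N * N)%N.
  by have := leq_card f finj; rewrite !card_prod !card_ord.
rewrite -(ler_nat R) !natrM => card.
have ma3 : N%:R * p - 1 <= ma%:R by rewrite -natr1 in ma2; lra.
have mb3 : N%:R * q - 1 <= mb%:R by rewrite -natr1 in mb2; lra.
have ma4 : 0 <= N%:R * p - 1.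
  by rewrite subr_ge0 -ler_pdivrMr// mul1r; rewrite /r in rN; lra.
have mb4 : 0 <= N%:R * q - 1.
  by rewrite subr_ge0 -ler_pdivrMr// mul1r; rewrite /r in rN; lra.
have h1 : (N%:R * p - 1) * (N%:R * q - 1) <= ma%:R * mb%:R by apply: ler_pM.
have h2 : n%:R * ((N%:R * p - 1) * (N%:R * q - 1)) <= N%:R * N%:R.
  by apply: le_trans card; rewrite -mulrA ler_wpM2l.
have h3 : 2 * n%:R < (n%:R * (p * q) - 1) * N%:R.
  by rewrite [ltRHS]mulrC -ltr_pdivrMr ?subr_gt0//; rewrite /r in rN; lra.
have n0 : 0 <= n%:R :> R by [].
have h4 : n%:R * (p + q) <= 2 * n%:R by rewrite [leRHS]mulrC ler_wpM2l//; lra.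
have h5 : ((n%:R * (p * q) - 1) * N%:R) * N%:R <= n%:R * (p + q) * N%:R.
  have -> : (n%:R * (p * q) - 1) * N%:R * N%:R =
    n%:R * ((N%:R * p - 1) * (N%:R * q - 1)) - N%:R * N%:R
    + n%:R * (p + q) * N%:R - n%:R :> R.
    by ring.
  lra.
by move: h5; rewrite ler_pM2r//; lra.
Qed.

End Packing.

(** * Finite counts, signs, and points off a line *)

Section Auxiliary.
Context {R : realType}.
Implicit Types (z w x y p : hplane R) (s t : R) (c : R -> hplane R).
Implicit Types (g h : hplane R -> hplane R).

(** Only finite families have to be bounded; finiteness of [A] follows, as an infinite set has
    finite subsets of every size. *)
Lemma counting_le (T : choiceType) (A : set T) (M : R) :
  (forall n (e : 'I_n -> T), injective e -> (forall i, A (e i)) -> n%:R <= M) ->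
  (counting A <= M%:E)%E.
Proof.
move=> AM.
have fset_le (B : {fset T}) : [set` B] `<=` A -> (#|` B|)%:R <= M.
  move=> BA; pose e (i : 'I_#|` B|) := (tnth (in_tuple (enum_fset B)) i).
  apply: (AM _ e).
    by apply/tuple_uniqP; exact: fset_uniq.
  by move=> i; apply: BA => /=; exact: mem_tnth.
rewrite /counting; case: asboolP => [Afin|Ainf].
  rewrite lee_fin; apply: fset_le => x /=.
  by rewrite in_fset_set// inE.
exfalso; have [B BA nB] := infinite_set_fset (Num.truncn M).+1 Ainf.
have := fset_le _ BA; apply/negP; rewrite -ltNge.
by apply: lt_le_trans (truncnS_gt M) _; rewrite ler_nat.
Qed.

Lemma finite_near (T : topologicalType) (I : Type) (F : set I) (Q : I -> set T) (x : T) :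
  finite_set F -> (forall i, F i -> nbhs x (Q i)) ->
  nbhs x [set y | forall i, F i -> Q i y].
Proof.
move=> Ffin FQ; pose F' : set {classic I} := F.
have [D FD] := (@finite_fsetP {classic I} F').1 Ffin.
have DQ i : i \in D -> nbhs x (Q i).
  by move=> iD; apply: FQ; rewrite -[F _]/(F' i) FD.
have := @filter_bigI T {classic I} D Q (nbhs x) (nbhs_filter x) DQ.
by apply: filterS => y yQ i Fi; apply: yQ; rewrite -FD.
Qed.

Lemma intr_norm_lt1 (k : int) : `|k%:~R| < 1 :> R -> k = 0.
Proof. by rewrite -intr_norm ltrz1; lia. Qed.

Lemma unit_interval_dist (r s : R) : 0 <= r < 1 -> 0 <= s < 1 -> `|r - s| < 1.
Proof.
by move=> /andP[? ?] /andP[? ?]; rewrite ltr_norml; apply/andP; split; lra.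
Qed.

Lemma near_same_sign (T : topologicalType) (f : T -> R) (i : T) :
  {for i, continuous f} -> f i != 0 -> \forall j \near i, 0 < f j * f i.
Proof.
move=> cf fi; have f2 : 0 < f i * f i by rewrite -expr2 exprn_even_gt0.
have cff : f j * f i @[j --> i] --> f i * f i.
  by apply: cvgM; [exact: cf|exact: cvg_cst].
exact: (cff _ (lt_nbhsr f2)).
Qed.

Lemma gline_range_eq c1 c2 x y : gline c1 -> gline c2 -> x <> y ->
  range c1 x -> range c1 y -> range c2 x -> range c2 y -> range c1 = range c2.
Proof.
move=> P1 P2 xy [s _ sx] [t _ ty] [s' _ s'x] [t' _ t'y].
apply: (gline_meet2_range _ _ s t s' t') => //; rewrite ?sx ?ty//.
by apply/eqP => st; apply: xy; rewrite -sx -ty st.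
Qed.

(** A line filling the plane would share two points with the vertical line [v], hence coincide with
    it, but [v] misses (1, 1). *)
Lemma gline_off_line c : gline c -> exists z, ~ range c z.
Proof.
move=> cP; apply: contrapT => none.
have all_c z : range c z by apply: contrapT => zc; apply: none; exists z.
pose v (t : R) : hplane R := mkh (0, expR t).
have vE t : set_val (v t) = (0, expR t) by rewrite set_val_mkh//= expR_gt0.
have vP : gline v.
  move=> s t; apply/hdistP; rewrite dot_mink !vE /= chE.
  by field; rewrite !gt_eqF ?expR_gt0.
have [t _ tE] : range v (mkh (1, 1)).
  rewrite -(gline_range_eq c v (v 0) (v 1) cP vP)//; try by [exists 0| exists 1].
  by move=> /(gline_inj _ vP)/eqP; rewrite eq_sym oner_eq0.
have := congr1 set_val tE; rewrite vE set_val_mkh//= => -[/eqP].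
by rewrite eq_sym oner_eq0.
Qed.

(** Moving from [x] towards a point off [c] leaves [c] at once, as a second common point would make
    the lines equal. *)
Lemma near_off_line c x (U : set (hplane R)) : gline c -> range c x -> nbhs x U ->
  exists2 y, U y & ~ range c y.
Proof.
move=> cP cx /hdist_nbhs[e e0 eU].
have [z cz] := gline_off_line c cP.
have xz : x <> z by move=> xz; apply: cz; rewrite -xz.
have [k [kP k0 kd]] := gline_through x z xz.
have Dx : hdist x (k (e / 2)) = e / 2.
  by rewrite -k0 kP sub0r normrN gtr0_norm// divr_gt0.
exists (k (e / 2)); first by apply: eU; rewrite Dx; lra.
move=> ck; apply: cz.
have -> : range c = range k; last by exists (hdist x z).
apply: (gline_range_eq _ _ x (k (e / 2))) => //.
- by move=> e'; move: Dx; rewrite -e' hdistxx; lra.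
- by exists 0.
Qed.

Lemma isometry_continuous g : hisometry g -> continuous g.
Proof.
move=> gi z.
apply: (@hplane_cvgP _ (hplane R) g (nbhs (z : hplane R)) (g z) _) => e e0.
near=> w; rewrite gi; near: w.
exact: nbhs_hball.
Unshelve. all: by end_near. Qed.

Lemma range_shift (B : R -> hplane R) g c (e : R) : (forall t, B (t + e) = g (B t)) ->
  range c = range B -> range (g \o c) = range B.
Proof.
move=> gE cB; apply/seteqP; split=> _ [t _ <-] /=.
  have [s _ <-] : range B (c t) by rewrite -cB; exists t.
  by exists (s + e).
have [s _ cs] : range c (B (t - e)) by rewrite cB; exists (t - e).
by exists s => //=; rewrite cs -gE subrK.
Qed.

(* So a line crosses a segment exactly when its linear form changes sign between the
   endpoints, which makes crossings stable under perturbation. *)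
Lemma side_segment c k (d t : R) : gline k -> 0 < t < d -> exists u v : R,
  [/\ 0 < u, 0 < v &
   side c (mink (k t)) = u * side c (mink (k 0)) + v * side c (mink (k d))].
Proof.
move=> kP /andP[t0 td]; have d0 : 0 != d by rewrite lt_eqF//; lra.
exists (sh (d - t) / sh d), (sh t / sh d); split.
- by rewrite divr_gt0// sh_gt0//; lra.
- by rewrite divr_gt0// sh_gt0//; lra.
- rewrite (geodesic_lincomb _ _ _ _ _ _ d0 (kP 0 d) (kP t 0) (kP t d)) side_lin.
  by rewrite !subr0.
Qed.

Lemma side_IVT c k (a b : R) : a <= b -> gline c -> gline k ->
  side c (mink (k a)) * side c (mink (k b)) < 0 ->
  exists2 t, a < t < b & range c (k t).
Proof.
move=> ab cP kP ab0; pose f (t : R) := side c (mink (k t)).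
have cf : {within `[a, b], continuous f}.
  apply: continuous_subspaceT => t.
  by apply: continuous_comp (gline_continuous _ kP t) (side_continuous c _).
have [|t] := IVT (f := f) (a := a) (b := b) (v := 0) ab cf.
  rewrite ge_min le_max; move: ab0; rewrite -/(f a) -/(f b).
  move: (f a) (f b) => x y xy.
  have [x0|x0] := leP x 0; have [y0|y0] := leP y 0 => //=;
    rewrite ?(ltW x0) ?(ltW y0)//; nra.
move=> tab ft; have ft0 : f t = 0 by [].
exists t; last by apply/side_eq0.
have ta : t != a by apply/eqP => ta; move: ab0; rewrite -ta -/(f t) ft0 mul0r ltxx.
have tb : t != b by apply/eqP => tb; move: ab0; rewrite -tb -/(f t) ft0 mulr0 ltxx.
by move: tab; rewrite in_itv /= !le_eqVlt eq_sym (negbTE ta) (negbTE tb).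
Qed.

End Auxiliary.

(** * Reducing parameters modulo a period *)

Section Periods.
Context {R : realType} (X : hyperbolic_surface R).
Implicit Types (z w x y p : hplane R) (s t : R) (c : R -> hplane R).
Implicit Types (g h : hplane R -> hplane R).

Lemma deck_period c g (a : R) : deck X g -> (forall t, c (t + a) = g (c t)) ->
  forall k : int, exists gk, deck X gk /\ forall t, c (t + k%:~R * a) = gk (c t).
Proof.
move=> gX cg; have [h hX [gh hg]] := deck_inv gX.
have ch t : c (t - a) = h (c t) by rewrite -[in RHS](subrK a t) cg gh.
elim/int_ind => [|n [k [kX kE]]|n [k [kX kE]]].
- by exists id; split=> [|t]; [exact: deck_id|rewrite mul0r addr0].
- exists (g \o k); split=> [|t /=]; first exact: deck_comp.
  by rewrite -kE -cg; congr c; rewrite -addn1 PoszD intrD; ring.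
- exists (h \o k); split=> [|t /=]; first exact: deck_comp.
  by rewrite -kE -ch; congr c; rewrite -addn1 PoszD !mulrNz intrD; ring.
Qed.

Lemma floor_period s (a : R) : 0 < a -> exists k : int, 0 <= s - k%:~R * a < a.
Proof.
move=> a0; exists (Num.floor (s / a)).
have := floor_itv (s / a); rewrite intrD ler_pdivlMr// ltr_pdivrMr//.
by move=> /andP[? ?]; apply/andP; split; lra.
Qed.

(** Infinitely many deck transformations carry [c] to the same line; finiteness arguments require
    the parameter to lie in one period. *)
Lemma deck_reduce c g (a : R) h s : 0 < a -> deck X g ->
  (forall t, c (t + a) = g (c t)) -> deck X h ->
  exists h' s', [/\ deck X h', 0 <= s' < a, h' (c s') = h (c s) &
    range (h' \o c) = range (h \o c)].
Proof.
move=> a0 gX cg hX; have [k ks] := floor_period s a a0.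
have [gk [gkX gkE]] := deck_period c g a gX cg k.
exists (h \o gk), (s - k%:~R * a); split=> //; first exact: deck_comp.
  by rewrite /= -gkE subrK.
apply/seteqP; split=> _ [t _ <-] /=; first by rewrite -gkE; exists (t + k%:~R * a).
by exists (t - k%:~R * a) => //=; rewrite -gkE subrK.
Qed.

End Periods.

(** * Perturbing a closed geodesic *)

Section Broken.
Context {R : realType}.
Implicit Types (G : int -> hplane R -> hplane R) (c : R -> hplane R) (d t : R).

(* The curve made of the translates by [G k] of the segment of [c] from 0 to [d], traversed
   for [t] between [k] and [k + 1]. *)
Definition broken G c d t : hplane R :=
  G (Num.floor t) (c (d * (t - (Num.floor t)%:~R))).

Lemma broken_piece G c d (k : int) t : (forall i, G (i + 1) (c 0) = G i (c d)) ->
  k%:~R <= t <= k%:~R + 1 -> broken G c d t = G k (c (d * (t - k%:~R))).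
Proof.
move=> Gc /andP[kt]; rewrite le_eqVlt => /orP[/eqP tE|tk].
  have fE : Num.floor t = k + 1.
    by apply: floor_def; rewrite tE !intrD lexx ltrDl ltr01.
  rewrite /broken fE tE intrD subrr mulr0 Gc; congr (G k (c _)); ring.
suff fE : Num.floor t = k by rewrite /broken fE.
by apply: floor_def; rewrite kt intrD.
Qed.

Lemma broken_int G c d (k : int) : broken G c d k%:~R = G k (c 0).
Proof. by rewrite /broken intrKfloor subrr mulr0. Qed.

Lemma broken_continuous G c d : 0 < d -> gline c -> (forall i, hisometry (G i)) ->
  (forall i, G (i + 1) (c 0) = G i (c d)) -> continuous (broken G c d).
Proof.
move=> d0 cP Gi Gc.
have piece (k : int) s t : k%:~R <= s <= k%:~R + 1 -> k%:~R <= t <= k%:~R + 1 ->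
    hdist (broken G c d s) (broken G c d t) = d * `|s - t|.
  move=> sk tk; rewrite !(broken_piece _ _ _ k)// Gi cP -mulrBr normrM gtr0_norm//.
  by congr (_ * `|_|); ring.
move=> t; apply: hplane_cvgP => e e0.
pose k := Num.floor t.
have /andP[tk1 tk2] := floor_itv t; rewrite -/k intrD in tk1 tk2.
have near_t : \forall s \near t, `|t - s| < e / d /\ k%:~R - 1 < s < k%:~R + 1.
  near=> s; split.
    by near: s; apply: (@cvgr_dist_lt _ R^o) => //; rewrite divr_gt0.
  apply/andP; split; near: s; [apply: lt_nbhsr|apply: lt_nbhsl]; lra.
apply: filterS near_t => s [st /andP[s1 s2]].
apply: (@le_lt_trans _ _ (d * `|t - s|)); last first.
  by rewrite mulrC -ltr_pdivlMr.
have [sk|/ltW sk] := leP k%:~R s.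
  by rewrite (piece k)//; apply/andP; split; lra.
apply: le_trans (hdist_triangle (broken G c d k%:~R) _ _) _.
rewrite (piece k); [|by apply/andP; split; lra|by apply/andP; split; lra].
rewrite (piece (k - 1)); first last.
- by rewrite intrD; apply/andP; split; lra.
- by rewrite intrD; apply/andP; split; lra.
rewrite !ger0_norm; lra.
Unshelve. all: by end_near. Qed.

End Broken.

(** * Crossings of lifts of A with the perturbed segment *)

Section Crossing.
Context {R : realType} (X : hyperbolic_surface R).
Context (A : R -> hplane R) (gA : hplane R -> hplane R) (a : R).
Context (AP : gline A) (gAX : deck X gA) (Ag : forall t, A (t + a) = gA (A t)).
Context (a0 : 0 < a).
Context (B : R -> hplane R) (gB : hplane R -> hplane R) (b : R).
Context (BP : gline B) (gBX : deck X gB) (Bg : forall t, B (t + b) = gB (B t)).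
Context (b0 : 0 < b).
Implicit Types (z w x y p : hplane R) (s t : R) (c : R -> hplane R).
Implicit Types (g h : hplane R -> hplane R).

Lemma deck_near_finite x (r : R) : finite_set
  [set h | deck X h /\ exists2 s, 0 <= s < a & hdist x (h (A s)) <= r].
Proof.
apply: sub_finite_set (deck_finite X (A 0) (hdist (A 0) x + r + a)) => h [hX [s sa xs]].
split=> //; apply: le_trans (hdist_triangle x _ _) _.
have h1 := hdist_triangle (h (A s)) x (h (A 0)).
rewrite (deck_isometry hX) AP subr0 ger0_norm in h1; last by case/andP: sa.
by case/andP: sa => *; lra.
Qed.

Lemma deck_gline h : deck X h -> gline (h \o A).
Proof. by move=> hX; apply: gline_comp AP; exact: deck_isometry hX. Qed.

(** Otherwise each point of one period of [B] is on a lift of [A] other than [B]. Finitely many deck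
    transformations provide these lifts, so one lift contains two points of [B] and is [B]. *)
Lemma exists_generic_basepoint :
  exists t0, forall h, deck X h -> range (h \o A) (B t0) -> range (h \o A) = range B.
Proof.
apply: contrapT => none.
have /choice[h hP] : forall t, exists h, deck X h /\ [/\
    exists2 s, 0 <= s < a & h (A s) = B t & range (h \o A) <> range B].
  move=> t; apply: contrapT => ht; apply: none; exists t => h hX [s _ hs].
  apply: contrapT => hB; apply: ht.
  have [h' [s' [h'X s'a h's' hh']]] := deck_reduce X A gA a h s a0 gAX Ag hX.
  exists h'; split=> //; rewrite hh'; split=> //; exists s' => //.
  by rewrite h's' -hs.
have [|s [t [_ _ st hst]]] := @finite_collision _ _ _ h 0 b b0 (deck_near_finite (B 0) b).
  move=> t /andP[t0 tb]; have [hX [[s sa hs] _]] := hP t; split=> //; exists s => //.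
  by rewrite hs BP sub0r normrN gtr0_norm// ltW.
have [hX [[s' _ hs'] hB]] := hP s; have [_ [[t' _ ht'] _]] := hP t.
apply: hB; rewrite -hst in ht'.
apply: (gline_range_eq _ _ (B s) (B t)) => //; first exact: deck_gline.
- by move=> /(gline_inj _ BP)/eqP; apply/negP.
- by exists s'.
- by exists t'.
Qed.

(** A lift not along [B] misses [B t0] and its image by [gB], so its linear form keeps its signs
    when these move to [p] and [gB p]. A crossing with the new segment forces opposite signs at the
    old endpoints, and the intermediate value theorem gives a crossing with [B]. *)
Lemma exists_perturbed_basepoint t0 :
  (forall h, deck X h -> range (h \o A) (B t0) -> range (h \o A) = range B) ->
  exists p, (forall h, deck X h -> ~ range (h \o A) p) /\
    forall c h s t, gline c -> c 0 = p -> c (hdist p (gB p)) = gB p ->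
      deck X h -> 0 <= s < a -> 0 < t < hdist p (gB p) -> h (A s) = c t ->
      exists s' t', [/\ h (A s') = B t', t0 <= t' < t0 + b &
        range (h \o A) = range B -> t' = t0].
Proof.
have b0' := b0; move=> good; pose p0 := B t0.
(* [p] will be within 1 of [p0], so the new segment has length at most [b + 2] and stays within
   [b + 3] of [p0]. *)
pose F := [set h | deck X h /\ exists2 s, 0 <= s < a & hdist p0 (h (A s)) <= b + 3].
pose Q h := [set p | range (h \o A) = range B \/
  (0 < side (h \o A) (mink p) * side (h \o A) (mink p0) /\
   0 < side (h \o A) (mink (gB p)) * side (h \o A) (mink (gB p0)))].
have gBi := deck_isometry gBX; have [gB' gB'X [gBK gB'K]] := deck_inv gBX.
have gBp0 : gB p0 = B (t0 + b) by rewrite Bg.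
have good' h : deck X h -> range (h \o A) (gB p0) -> range (h \o A) = range B.
  move=> hX [s _ hs].
  have e : range (gB' \o h \o A) = range B.
    by apply: good; [exact: deck_comp|exists s => //=; rewrite -[h _]/((h \o A) s) hs gBK].
  have <- : gB \o (gB' \o h \o A) = h \o A by apply/funext => t /=; rewrite gB'K.
  exact: (range_shift B gB _ b Bg e).
have nbQ : nbhs p0 [set p | forall h, F h -> Q h p].
  apply: finite_near; first exact: deck_near_finite.
  move=> h [hX _].
  have [hB|hB] := pselect (range (h \o A) = range B); first by apply: filterE => y; left.
  have hAP := deck_gline h hX.
  have c1 : side (h \o A) (mink p0) != 0.
    by apply/eqP => /(side_eq0 _ _ hAP)/good; auto.
  have c2 : side (h \o A) (mink (gB p0)) != 0.
    by apply/eqP => /(side_eq0 _ _ hAP)/good'; auto.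
  near=> y; right; split; near: y.
    exact: near_same_sign (side_continuous _ p0) c1.
  have cg : {for p0, continuous (fun y => side (h \o A) (mink (gB y)))}.
    apply: (@continuous_comp _ _ _ gB (fun y => side (h \o A) (mink y))).
      exact: isometry_continuous.
    exact: side_continuous.
  exact: near_same_sign cg c2.
(* The signs keep [p] off the other lifts nearby; choosing [p] off [B] deals with the lifts along
   [B]. *)
have [p [pQ pp0] pB] : exists2 p, (forall h, F h -> Q h p) /\ hdist p0 p < 1 & ~ range B p.
  apply: (near_off_line B p0 [set p | (forall h, F h -> Q h p) /\ hdist p0 p < 1]) => //.
  apply: (filterI nbQ); exact: (nbhs_hball p0 1 ltr01).
have near_F h s : deck X h -> 0 <= s < a -> hdist p0 (h (A s)) <= b + 3 ->
    range (h \o A) = range B \/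
    (0 < side (h \o A) (mink p) * side (h \o A) (mink p0) /\
     0 < side (h \o A) (mink (gB p)) * side (h \o A) (mink (gB p0))).
  by move=> hX sa hs; apply: pQ; split=> //; exists s.
exists p; split.
  move=> h hX [s _ hs].
  have [h' [s' [h'X s'a h's' hh']]] := deck_reduce X A gA a h s a0 gAX Ag hX.
  have hp : range (h' \o A) p by rewrite hh'; exists s.
  have [||] := near_F h' s' h'X s'a.
  - have -> : h' (A s') = p by rewrite h's'.
    apply: ltW; apply: lt_trans pp0 _; lra.
  - by move=> e; apply: pB; rewrite -e.
  - move=> [+ _]; have /(side_eq0 _ _ (deck_gline _ h'X)) -> := hp.
    by rewrite mul0r ltxx.
set d := hdist p (gB p).
move=> c h s t cP c0 cd hX sa td hst.
have hAP := deck_gline h hX.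
have db : d <= b + 2.
  have h1 := hdist_triangle p0 p (gB p).
  have h2 := hdist_triangle (gB p0) p0 (gB p).
  have h3 : hdist p0 (gB p0) = b.
    by rewrite gBp0 BP opprD addrA subrr sub0r normrN gtr0_norm.
  rewrite gBi h3 in h2; rewrite (hdistC p p0) in h1; rewrite /d; lra.
have hp0 : hdist p0 (h (A s)) <= b + 3.
  apply: le_trans (hdist_triangle p _ _) _.
  have ct : hdist p (c t) = t.
    by rewrite -{1}c0 cP sub0r normrN gtr0_norm//; case/andP: td.
  by rewrite hst ct; case/andP: td => *; lra.
have [e|[s1 s2]] := near_F h s hX sa hp0.
  have : range (h \o A) (B t0) by rewrite e; exists t0.
  move=> [s' _ hs']; exists s', t0; split=> //.
  by rewrite lexx ltrDl.
have hnB : range (h \o A) <> range B.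
  move=> e; move: s1; have /(side_eq0 _ _ hAP) -> : range (h \o A) p0.
    by rewrite e; exists t0.
  by rewrite mulr0 ltxx.
have [u [v [u0 v0]]] := side_segment (h \o A) c d t cP td.
have /(side_eq0 _ _ hAP) -> : range (h \o A) (c t) by exists s.
rewrite c0 cd => /esym uv.
have opp : side (h \o A) (mink (B t0)) * side (h \o A) (mink (B (t0 + b))) < 0.
  rewrite -gBp0 -/p0; move: s1 s2 uv.
  move: (side _ (mink p)) (side _ (mink p0)) (side _ (mink (gB p))) (side _ (mink (gB p0))).
  move=> x x0 y y0 xx yy uv.
  have y2 : 0 < y ^+ 2.
    by rewrite exprn_even_gt0//; apply/eqP => yE; move: yy; rewrite yE mul0r ltxx.
  have xyE : u * (x * y) = - (v * y ^+ 2).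
    rewrite mulrA (_ : u * x = - (v * y)); [ring|lra].
  have xy : x * y < 0.
    by rewrite -(pmulr_rlt0 _ u0) xyE oppr_lt0 mulr_gt0.
  by rewrite -(nmulr_rgt0 _ xy) mulrACA mulr_gt0.
have [|t' tb [s' _ hs']] := side_IVT (h \o A) B t0 (t0 + b) _ hAP BP opp.
  by rewrite lerDl ltW.
by exists s', t'; split=> //; case/andP: tb => /ltW -> ->.
Unshelve. all: by end_near. Qed.

End Crossing.

(** * Nearby crossings come from the same pair of lifts *)

Section Separation.
Context {R : realType} (X : hyperbolic_surface R).
Implicit Types (z w x y p : hplane R) (s t : R) (c : R -> hplane R).
Implicit Types (g h : hplane R -> hplane R).

(* Two crossings of a lift of each geodesic within [L] of each other would
   bound a loop shorter than the displacement [2 L] of every deck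
   transformation, so they belong to the same pair of lifts. *)
Lemma crossing_separation A gA (a : R) B gB (b : R) (L t0 : R) hi hj (ui vi uj vj : R)
    (k l : int) :
  gline A -> deck X gA -> (forall t, A (t + a) = gA (A t)) ->
  gline B -> deck X gB -> (forall t, B (t + b) = gB (B t)) -> L <= b ->
  (forall g z, deck X g -> g <> id -> 2 * L <= hdist z (g z)) ->
  deck X hi -> deck X hj -> hi (A ui) = B vi -> hj (A uj) = B vj ->
  t0 <= vi < t0 + b -> t0 <= vj < t0 + b ->
  (range (hi \o A) = range B -> vi = t0) ->
  (range (hj \o A) = range B -> vj = t0) ->
  `|ui - uj - k%:~R * a| < L -> `|vi - vj - l%:~R * b| < L ->
  forall s, hi (A (s + k%:~R * a)) = hj (A s).
Proof.
move=> AP gAX Ag BP gBX Bg Lb disp hiX hjX hui huj vit vjt vi0 vj0 uk vl.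
have [gk [gkX gkE]] := deck_period X A gA a gAX Ag k.
have [gl [glX glE]] := deck_period X B gB b gBX Bg l.
have [gk' gk'X [gkK gkK']] := deck_inv gkX.
have [hi' hi'X [hiK hiK']] := deck_inv hiX.
have hiP : gline (hi \o A) := gline_comp _ _ (deck_isometry hiX) AP.
have huj' : gl (hj (gk' (A (uj + k%:~R * a)))) = B (vj + l%:~R * b).
  by rewrite gkE gkK huj glE.
(* This map sends [hi (A (uj + k%:~R * a))] to [B (vj + l%:~R * b)], and both points are within [L]
   of [B vi]. *)
have same : gl \o hj \o gk' \o hi' = id.
  apply: contrapT => neq.
  have fX : deck X (gl \o hj \o gk' \o hi').
    exact: (deck_comp (deck_comp (deck_comp glX hjX) gk'X) hi'X).
  have := disp _ (hi (A (uj + k%:~R * a))) fX neq.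
  rewrite /= hiK huj' leNgt => /negP; apply.
  apply: le_lt_trans (hdist_triangle (B vi) _ _) _.
  rewrite -{1}hui (deck_isometry hiX) AP BP distrC opprD addrA.
  by rewrite opprD addrA in vl *; lra.
have hjE s : hi (A (s + k%:~R * a)) = gl (hj (A s)).
  rewrite -[LHS]/(id (hi (A (s + k%:~R * a)))) -same /= hiK gkE gkK //.
have huj2 : hi (A (uj + k%:~R * a)) = B (vj + l%:~R * b) by rewrite hjE huj glE.
suff l0 : l = 0.
  move=> s; rewrite hjE; suff -> : gl = id by [].
  apply: (deck_uniq X _ _ (B 0) glX (deck_id X)).
  by rewrite -glE l0 mul0r addr0.
have small_l (i : int) : `|i%:~R * b| < b -> i = 0.
  have b0 : 0 < b by case/andP: vit; lra.
  rewrite normrM (gtr0_norm b0) -[ltRHS]mul1r ltr_pM2r//; exact: intr_norm_lt1.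
(* Crossings along [B] are all recorded at [t0], so [l] periods amount to less than [L <= b].
   Otherwise the lines meet once, and [vi - vj], which is less than [b] in size, is exactly [l]
   periods. *)
have [e|e] := pselect (range (hi \o A) = range B).
  have ej : range (hj \o A) = range B.
    have [gl' gl'X [glK glK']] := deck_inv glX.
    have gl'E t : B (t + - (l%:~R * b)) = gl' (B t).
      by rewrite -{2}(subrK (l%:~R * b) t) glE glK.
    have <- : gl' \o (gl \o hj \o A) = hj \o A by apply/funext => s /=; rewrite glK.
    apply: (range_shift B gl' _ _ gl'E); rewrite -e.
    apply/seteqP; split=> _ [s _ <-] /=.
      by exists (s + k%:~R * a) => //; rewrite /= hjE.
    by exists (s - k%:~R * a) => //=; rewrite -hjE subrK.
  apply: small_l; move: vl; rewrite (vi0 e) (vj0 ej) subrr sub0r normrN => vl.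
  exact: lt_le_trans vl Lb.
have uE : ui = uj + k%:~R * a.
  apply: contrapT => /eqP ne; apply: e.
  exact: (gline_meet2_range _ _ ui (uj + k%:~R * a) vi (vj + l%:~R * b)).
have vE : vi = vj + l%:~R * b.
  by apply: (gline_inj _ BP); rewrite -hui uE huj2.
apply: small_l; have -> : l%:~R * b = vi - vj by rewrite vE; ring.
by rewrite ltr_norml; apply/andP; split; lra.
Qed.

End Separation.

(** * Transversality and equivariance of the broken geodesic *)

Section BrokenLoop.
Context {R : realType} (X : hyperbolic_surface R).
Implicit Types (z w x y p : hplane R) (s t : R) (c : R -> hplane R).
Implicit Types (g h : hplane R -> hplane R) (G : int -> hplane R -> hplane R).

(** No lift of [A] contains a corner, so a crossing is interior to a piece, and the line of that
    piece, which contains a corner, differs from the lift. *)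
Lemma geodesic_broken_transversal A (a : R) G c (d : R) :
  gline A -> 0 < a -> gline c -> 0 < d -> (forall i, deck X (G i)) ->
  (forall i, G (i + 1) (c 0) = G i (c d)) ->
  (forall h, deck X h -> ~ range (h \o A) (c 0)) ->
  transversal_loops (surface_proj X \o (fun t => A (a * t)))
                    (surface_proj X \o broken G c d).
Proof.
move=> AP a0 cP d0 GX Gc cA s t /= /projP[h hX hst].
pose k := Num.floor t.
have GP : gline (G k \o c) := gline_comp _ _ (deck_isometry (GX k)) cP.
have hP : gline (h \o A) := gline_comp _ _ (deck_isometry hX) AP.
have [Gk GkX [GK GK']] := deck_inv (GX k).
have hG0 : ~ range (h \o A) (G k (c 0)).
  move=> [s' _ hs']; apply: (cA (Gk \o h)); first exact: deck_comp.
  by exists s' => //=; rewrite -[h _]/((h \o A) s') hs' GK.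
have /andP[kt tk] := floor_itv t; rewrite -/k intrD in kt tk.
have {}kt : k%:~R < t.
  rewrite lt_neqAle kt andbT; apply/eqP => ktE; apply: hG0.
  by exists (a * s) => //=; rewrite hst -ktE broken_int.
have near_t : \forall x \near t, broken G c d x = (G k \o c) (- (d * k%:~R) + d * x).
  near=> x; rewrite (broken_piece _ _ _ k)//.
    by congr (G k (c _)); ring.
  apply/andP; split; apply: ltW; near: x; [exact: lt_nbhsr|exact: lt_nbhsl].
have bt := nbhs_singleton near_t.
exists (fun u : R => (h \o A) (0 + a * u)).
exists (fun u : R => (G k \o c) (- (d * k%:~R) + d * u)).
split.
- by apply: filterE => x /=; rewrite add0r proj_deck.
- by apply: filterS near_t => x /= ->.
- by rewrite add0r -bt.
have [dx1 dy1] := gline_affine_derive (h \o A) 0 a s hP.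
have [dx2 dy2] := gline_affine_derive (G k \o c) (- (d * k%:~R)) d t GP.
have : range (h \o A) <> range (G k \o c).
  by move=> e; apply: hG0; rewrite e; exists 0.
have e1 : (h \o A) (0 + a * s) = (G k \o c) (- (d * k%:~R) + d * t).
  by rewrite add0r -bt.
move=> /(velocity_transversal _ _ _ _ hP GP e1).
move: (velocity (h \o A) _) (velocity (G k \o c) _) dx1 dy1 dx2 dy2.
move=> u v dx1 dy1 dx2 dy2 uv.
exists (a * u.1, a * u.2), (d * v.1, d * v.2); split => //=.
have -> : a * u.1 * (d * v.2) - a * u.2 * (d * v.1) =
    a * d * (u.1 * v.2 - u.2 * v.1) by ring.
by rewrite mulf_neq0// mulf_neq0// gt_eqF.
Unshelve. all: by end_near. Qed.

Lemma broken_equivariant G c (d : R) g : (forall i z, G (i + 1) z = g (G i z)) ->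
  forall t, broken G c d (t + 1) = g (broken G c d t).
Proof.
move=> Gg t; have fE : Num.floor (t + 1) = Num.floor t + 1.
  apply: floor_def; have := floor_itv t; rewrite !intrD => /andP[? ?].
  by apply/andP; split; lra.
rewrite /broken fE Gg intrD; congr (g (G _ (c _))); ring.
Qed.

(** The holonomies of [B] over [k] periods serve as the integer powers of [g]; freeness turns
    identities at [B 0] into identities of maps. *)
Lemma deck_powers B g (b : R) : deck X g -> (forall t, B (t + b) = g (B t)) ->
  exists G : int -> hplane R -> hplane R,
  [/\ forall k, deck X (G k), G 0 = id,
      forall k z, G (k + 1) z = G k (g z) & forall k z, G (k + 1) z = g (G k z)].
Proof.
move=> gX Bg; have /choice[G GP] := deck_period X B g b gX Bg.
have GX k := (GP k).1; have GE k := (GP k).2.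
exists G; split=> //.
- apply: (deck_uniq X _ _ (B 0) (GX 0) (deck_id X)).
  by rewrite -GE mul0r addr0.
- move=> k; apply/funeqP; apply: (deck_uniq X _ (G k \o g) (B 0)) => //.
    exact: deck_comp.
  by rewrite /= -GE -Bg -GE; congr B; rewrite intrD; ring.
- move=> k; apply/funeqP; apply: (deck_uniq X _ (g \o G k) (B 0)) => //.
    exact: deck_comp.
  by rewrite /= -!GE -Bg; congr B; rewrite intrD; ring.
Qed.

End BrokenLoop.

(** * Counting the crossings of the two representatives *)

Theorem proposition2p4 (R : realType) (X : hyperbolic_surface R)
    (X_compact : compact [set: points X]) (alpha beta : closed_geodesic X) :
  (intersection_number alpha beta <=
    (4 / systole X ^+ 2 * geodesic_length alpha * geodesic_length beta)%:E)%E.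
Proof.
have [A [gA [AP gAX Af Ag]]] := closed_geodesic_lift X alpha.
have [B [gB [BP gBX Bf Bg]]] := closed_geodesic_lift X beta.
have gBI := closed_geodesic_deck_neq_id X beta B gB BP Bg.
have a0 := geodesic_length_gt0 alpha; have b0 := geodesic_length_gt0 beta.
have [sys0 disp] := systole_displacement X alpha X_compact.
have La := systole_le_length X alpha; have Lb := systole_le_length X beta.
have [t0 good] := exists_generic_basepoint X A gA _ AP gAX Ag a0 B _ BP b0.
have [p [pA cross]] :=
  exists_perturbed_basepoint X A gA _ AP gAX Ag a0 B gB _ BP gBX Bg b0 t0 good.
have pgp : p <> gB p by move=> e; apply: gBI; exact: (deck_free gBX (esym e)).
have [c [cP c0 cd]] := gline_through p (gB p) pgp.
have d0 : 0 < hdist p (gB p).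
  by rewrite lt_neqAle hdist_ge0 andbT; apply/eqP => /esym/hdist_eq0.
have [G [GX G0 GgB gBG]] := deck_powers X B gB _ gBX Bg.
move: (hdist p (gB p)) d0 cd cross => d d0 cd cross.
have Gc k : G (k + 1) (c 0) = G k (c d) by rewrite cd c0 GgB.
set a := geodesic_length alpha in Ag a0 La cross *.
set b := geodesic_length beta in Bg b0 Lb cross *.
pose a' := surface_proj X \o (fun t => A (a * t)).
have alphaE : geodesic_loop alpha = a' by apply/funext => t; rewrite /geodesic_loop Af.
have betaE : geodesic_loop beta = surface_proj X \o (fun t => B (b * t)).
  by apply/funext => t; rewrite /geodesic_loop Bf.
pose b' := surface_proj X \o broken G c d.
have Ac (k : R) : continuous (fun t => A (k * t)).
  move=> t; apply: continuous_comp (gline_continuous _ AP _).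
  exact: mulrl_continuous.
have Bc (k : R) : continuous (fun t => B (k * t)).
  move=> t; apply: continuous_comp (gline_continuous _ BP _).
  exact: mulrl_continuous.
have bc : continuous (broken G c d).
  by apply: broken_continuous => // i; exact: deck_isometry (GX i).
have Aeq t : A (a * (t + 1)) = gA (A (a * t)) by rewrite mulrDr mulr1 Ag.
have Beq t : B (b * (t + 1)) = gB (B (b * t)) by rewrite mulrDr mulr1 Bg.
have beq := broken_equivariant G c d gB gBG.
have loop g (f : R -> hplane R) : deck X g -> continuous f ->
    (forall t, f (t + 1) = g (f t)) -> is_loop (surface_proj X \o f).
  move=> gX cf fg; split=> [t|t /=]; last by rewrite fg proj_deck.
  by apply: continuous_comp (cf t) _; exact: surface_proj_continuous.
apply: (@le_trans _ _ (counting (intersections a' b'))).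
  apply: ereal_inf_lbound; exists a', b'; split=> //.
  - split; first exact: loop gAX (Ac a) Aeq.
    by rewrite alphaE; exact: (equivariant_freely_homotopic X gA).
  - split; first exact: loop gBX bc beq.
    by rewrite betaE; exact: (equivariant_freely_homotopic X gB).
  - by apply: geodesic_broken_transversal => //; rewrite c0.
apply: counting_le => n e einj eI.
(* Records for each crossing its lift of [A], with the parameters on [A] and on [B] of a crossing of
   that lift with [B]. *)
have /choice[v vP] : forall i, exists v : (hplane R -> hplane R) * R * R,
    [/\ deck X v.1.1, v.1.1 (A (a * (e i).1)) = c (d * (e i).2),
        v.1.1 (A v.1.2) = B v.2, t0 <= v.2 < t0 + b &
        range (v.1.1 \o A) = range B -> v.2 = t0].
  move=> i; have [+ + /projP[h hX hst]] := eI i.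
  rewrite !in_itv /= => /andP[s_ge0 s_lt1] /andP[t_ge0 t_lt1].
  have tpiece : broken G c d (e i).2 = c (d * (e i).2).
    by rewrite (broken_piece _ _ _ 0)// ?G0 ?subr0// t_ge0 /= add0r ltW.
  rewrite tpiece in hst.
  (* [cross] concerns interior points of the segment; at parameter 0 the curve is at [p], which no
     lift of [A] contains. *)
  have tn0 : (e i).2 != 0.
    apply/eqP => t_0; apply: (pA h hX); exists (a * (e i).1) => //=.
    by rewrite hst t_0 mulr0 c0.
  have [||s' [t' [hst' tt' tB]]] :=
      cross c h (a * (e i).1) (d * (e i).2) cP c0 cd hX _ _ hst.
  - rewrite mulr_ge0 ?(ltW a0)//=; have := ltr_pM2l a0 (e i).1 1.
    by rewrite mulr1 s_lt1.
  - have t_gt0 : 0 < (e i).2 by rewrite lt_neqAle eq_sym tn0.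
    rewrite mulr_gt0//=.
    by have := ltr_pM2l d0 (e i).2 1; rewrite mulr1 t_lt1.
  by exists (h, s', t').
pose L := systole X / 2.
have L0 : 0 < L by rewrite divr_gt0.
have sep (i j : 'I_n) (k l : int) : `|(v i).1.2 - (v j).1.2 - k%:~R * a| < L ->
    `|(v i).2 - (v j).2 - l%:~R * b| < L -> i = j.
  move=> uk vl; have [hiX hi hi' vi vi0] := vP i; have [hjX hj hj' vj vj0] := vP j.
  have Lb' : L <= b by rewrite /L; lra.
  have disp2 g z : deck X g -> g <> id -> 2 * L <= hdist z (g z).
    by move=> gX gI; have := disp g z gX gI; rewrite /L; lra.
  have hij := crossing_separation X A gA a B gB b L t0 _ _ _ _ _ _ k l AP gAX Ag BP gBX Bg
    Lb' disp2 hiX hjX hi' hj' vi vj vi0 vj0 uk vl.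
  have hiP : gline ((v i).1.1 \o A) := gline_comp _ _ (deck_isometry hiX) AP.
  have hj2 : (v i).1.1 (A (a * (e j).1 + k%:~R * a)) = c (d * (e j).2) by rewrite hij hj.
  (* The line [c] contains [p], so it is not this lift of [A]; they meet at most once, and the two
     crossings are one point. *)
  have sE : a * (e i).1 = a * (e j).1 + k%:~R * a.
    apply: contrapT => /eqP ne; apply: (pA _ hiX).
    rewrite (gline_meet2_range _ _ _ _ _ _ hiP cP ne hi hj2).
    by exists 0.
  have tE : (e i).2 = (e j).2.
    apply: (mulfI (lt0r_neq0 d0)); apply: (gline_inj _ cP).
    by rewrite -hi -hj2 sE.
  have {}sE : (e i).1 = (e j).1 + k%:~R.
    by apply: (mulfI (lt0r_neq0 a0)); rewrite sE; ring.
  (* The parameters lie in the half-open interval [0, 1), so they cannot differ by a nonzero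
     integer. *)
  have k0 : k = 0.
    have [+ _ _] := eI i; have [+ _ _] := eI j.
    rewrite !in_itv /= => sj si; apply: (@intr_norm_lt1 R).
    have -> : k%:~R = (e i).1 - (e j).1 by rewrite sE; ring.
    exact: unit_interval_dist.
  apply: einj; rewrite [LHS]surjective_pairing [RHS]surjective_pairing tE sE k0.
  by rewrite addr0.
have := torus_packing n (fun i => (v i).1.2) (fun i => (v i).2) a b L L0 _ _ sep.
move=> /(_ ltac:(rewrite /L; lra) ltac:(rewrite /L; lra)).
have -> : 4 / systole X ^+ 2 * a * b = a * b / L ^+ 2.
  by rewrite /L; field; rewrite gt_eqF.
by rewrite ler_pdivlMr ?exprn_gt0.
Qed.
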